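(* Let $k$ be a field and let $1\le n\le 5$. Then the category $\mathcal S_k(n)$ has finite representation type (only finitely many isomorphism classes of indecomposable objects), and the number $s(n)$ of isomorphism classes of indecomposable objects in $\mathcal S_k(n)$ is $$s(n)=2+2(n-1)\frac{6}{6-n}.$$
   Context: For a field $k$ and $n\ge 1$, $\mathcal S_k(n)$ is the category whose objects are triples $(V,U,T)$ where $V$ is a finite-dimensional $k$-space, $T\colon V\to V$ is a linear operator with $T^n=0$, and $U\subseteq V$ is a subspace with $T(U)\subseteq U$. A map $(V,U,T)\to(V',U',T')$ is a $k$-linear map $f\colon V\to V'$ with $f(U)\subseteq U'$ and $fT=T'f$. Direct sums are formed componentwise; an object is indecomposable if it is non-zero and not isomorphic to a direct sum of two non-zero objects. *)

(* Defs.v *)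
From HB Require Import structures.
From mathcomp Require Import all_boot all_order all_algebra.

Set Implicit Arguments.
Unset Strict Implicit.
Unset Printing Implicit Defensive.

Import GRing.Theory.
Local Open Scope ring_scope.

(* The nilpotency axiom [T ^ n = 0] is stated pointwise because ['End(V)]
   carries no ring structure in the library when [V] may be zero.           *)
Record invSubspace (k : fieldType) (n : nat) := InvSubspace {
  space : vectType k;
  subsp : {vspace space};
  oper : 'End(space);
  oper_nilp : forall v : space, iter n oper v = 0;
  oper_stable : (oper @: subsp <= subsp)%VS
}.

Section Category.
Variables (k : fieldType) (n : nat).
Implicit Types X Y Z : invSubspace k n.

Definition is_morphism X Y (f : 'Hom(space X, space Y)) : Prop :=
  (f @: subsp X <= subsp Y)%VS /\ (f \o oper X = oper Y \o f)%VF.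

Definition isomorphic X Y : Prop :=
  exists (f : 'Hom(space X, space Y)) (g : 'Hom(space Y, space X)),
    [/\ is_morphism f, is_morphism g,
        (g \o f = \1)%VF & (f \o g = \1)%VF].

Definition nonzero X : Prop := exists v : space X, v != 0.

Section DirectSum.
Variables X Y : invSubspace k n.

Definition dsum_fun (p : space X * space Y) : space X * space Y :=
  (oper X p.1, oper Y p.2).

Fact dsum_fun_linear : linear dsum_fun.
Proof. by move=> a p q; rewrite /dsum_fun /= !linearP. Qed.

HB.instance Definition _ :=
  GRing.isLinear.Build k _ _ *:%R dsum_fun dsum_fun_linear.

Definition dsum_oper : 'End((space X * space Y)%type) := linfun dsum_fun.

Definition dsum_subsp : {vspace (space X * space Y)%type} :=
  (linfun (@fst (space X) (space Y)) @^-1: subsp X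
   :&: linfun (@snd (space X) (space Y)) @^-1: subsp Y)%VS.

Lemma dsum_operE p : dsum_oper p = (oper X p.1, oper Y p.2).
Proof. by rewrite lfunE. Qed.

Lemma mem_dsum_subsp p :
  (p \in dsum_subsp) = (p.1 \in subsp X) && (p.2 \in subsp Y).
Proof. by rewrite memv_cap -!memv_preim !lfunE. Qed.

Fact dsum_nilp p : iter n dsum_oper p = 0.
Proof.
suff -> m : iter m dsum_oper p = (iter m (oper X) p.1, iter m (oper Y) p.2).
  by rewrite !oper_nilp.
by elim: m => [|m IHm] /=; [case: p | rewrite IHm dsum_operE].
Qed.

Fact dsum_stable : (dsum_oper @: dsum_subsp <= dsum_subsp)%VS.
Proof.
apply/subvP => _ /memv_imgP[p + ->].
rewrite dsum_operE !mem_dsum_subsp /= => /andP[p1 p2].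
by rewrite !(subvP (oper_stable _)) // memv_img.
Qed.

Definition dsum : invSubspace k n := InvSubspace dsum_nilp dsum_stable.

End DirectSum.

Definition indecomposable X : Prop :=
  nonzero X /\
  ~ (exists Y Z, [/\ nonzero Y, nonzero Z & isomorphic X (dsum Y Z)]).

End Category.

Definition finite_representation_type (k : fieldType) (n : nat) : Prop :=
  exists (m : nat) (X : 'I_m -> invSubspace k n),
    forall Y, indecomposable Y -> exists i, isomorphic Y (X i).

(* [X] is a complete irredundant list of representatives of the isomorphism
   classes of indecomposable objects; such an [s] is unique when it exists.  *)
Definition num_indecomposables (k : fieldType) (n s : nat) : Prop :=
  exists X : 'I_s -> invSubspace k n,
    [/\ forall i, indecomposable (X i),
        forall i j, isomorphic (X i) (X j) -> i = j &
        forall Y, indecomposable Y -> exists i, isomorphic Y (X i)].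

(* Main.v *)
From Stdlib Require Import Setoid.
From HB Require Import structures.
From mathcomp Require Import all_boot all_order all_algebra.
Require Import Defs.

(** The classification rests on Auslander's criterion: a finite list X_1, ..., X_m of objects
    with local endomorphism rings contains every indecomposable object as soon as the
    endomorphism algebra of M = X_1 + ... + X_m has global dimension at most 2 and every object
    is the kernel of a morphism between sums of listed objects.  For n = 5 the list is explicit:
    50 objects given by integer matrices.  The global dimension is bounded by giving, for each
    X_j, an exact sequence 0 -> K_j -> E_j -> X_j whose first two terms are sums of listed
    objects and through which every non-isomorphism X_i -> X_j factors; applying Hom(M, -)
    yields a projective resolution of length 2 of the j-th simple module.

    Every object Y is the kernel of a morphism between sums of the two listed injective objects
    ([kernel_presentation]), and [kernel_in_add] shows that such kernels are direct summands of
    sums of listed objects.  The latter is an induction on the codimension of the image of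
    Hom(M, A) in Hom(M, B), for h : A -> B.  If the image is everything, then h is a split
    epimorphism.  Otherwise some m : X_j -> B lies outside the image although its composite
    with g_j : E_j -> X_j factors through h ([socle]); enlarging A by X_j lowers the
    codimension, and a Schanuel argument exhibits the kernel of h as a direct summand of K_j
    plus the kernel of the enlarged map.  Locality of the rings End(X_i) then gives the
    Krull-Schmidt statement [indec_in_add].

    The factorization property is a count.  Left exactness of Hom(X_i, -) shows that the maps
    X_i -> X_j through g_j form a space of dimension hom(X_i, E_j) - hom(X_i, K_j), so it
    suffices that
      hom(X_i, E_j) + [i = j] = hom(X_i, X_j) + hom(X_i, K_j)      for all i, j.
    The 2500 numbers hom(X_i, X_j) come from Gaussian elimination on integer linear systems in
    which every pivot turns out to be 1 or -1, so that they are the same over all fields.  The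
    identity also tells the X_i apart.  Each basis is chosen such that endomorphisms of X_i are
    triangular with constant diagonal, which is read off from the same elimination and makes
    End(X_i) local.

    For n < 5 the category is the full subcategory of the objects of the case n = 5 on which
    T^n vanishes, and the list is filtered accordingly: 2, 5, 10, 20 and 50 objects remain. *)

Set Implicit Arguments.
Unset Strict Implicit.
Unset Printing Implicit Defensive.

Import GRing.Theory.
Local Open Scope ring_scope.

(** * Spaces of morphisms, direct sums and kernels *)

Local Open Scope lfun_scope.

Lemma linfunE (k : fieldType) (V W : vectType k) (f : V -> W) :
  linear f -> linfun f =1 f.
Proof.
move=> lf; pose F : {linear V -> W} := HB.pack f (GRing.isLinear.Build _ _ _ _ f lf).
exact: (lfunE F).
Qed.

Section Morphisms.
Variables (k : fieldType) (n : nat).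
Implicit Types X Y Z : invSubspace k n.

(** Both conditions on a morphism are linear in f; stability f U <= U' says that f composed
    with a projection onto U is fixed by a projection onto U'. *)
Definition mor_defect X Y (f : 'Hom(space X, space Y)) :=
  ((f \o oper X) - (oper Y \o f), (\1 - projv (subsp Y)) \o (f \o projv (subsp X))).

Lemma mor_defect_linear X Y : linear (@mor_defect X Y).
Proof.
move=> a f g; congr pair.
  by rewrite /= comp_lfunDl comp_lfunDr -comp_lfunZl -comp_lfunZr opprD scalerBr addrACA.
by rewrite /= (comp_lfunDl (a *: f)) comp_lfunDr -comp_lfunZl -comp_lfunZr.
Qed.

Definition mor X Y := lker (linfun (@mor_defect X Y)).

Lemma morP X Y f : reflect (is_morphism f) (f \in mor X Y).
Proof.
rewrite memv_ker (linfunE (@mor_defect_linear X Y)).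
apply: (iffP eqP) => [[/eqP fT fU]|[fU fT]].
  split; last by apply/eqP; rewrite -subr_eq0.
  apply/subvP => _ /memv_imgP[u Uu ->].
  move/lfunP/(_ u): fU; rewrite !(comp_lfunE, add_lfunE, opp_lfunE, id_lfunE, zero_lfunE).
  by rewrite projv_id // => /subr0_eq ->; apply: memv_proj.
congr pair; first by apply/eqP; rewrite subr_eq0; apply/eqP.
apply/lfunP => v; rewrite !(comp_lfunE, add_lfunE, opp_lfunE, id_lfunE, zero_lfunE).
by rewrite (@projv_id _ _ (subsp Y)) ?subrr // (subvP fU) // memv_img ?memv_proj.
Qed.

Lemma mor_intro X Y (f : 'Hom(space X, space Y)) :
  (forall u, u \in subsp X -> f u \in subsp Y) ->
  (forall v, f (oper X v) = oper Y (f v)) -> f \in mor X Y.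
Proof.
move=> fU fT; apply/morP; split; last by apply/lfunP => v; rewrite !comp_lfunE.
by apply/subvP => _ /memv_imgP[u Uu ->]; apply: fU.
Qed.

Lemma morU X Y f u : f \in mor X Y -> u \in subsp X -> f u \in subsp Y.
Proof. by case/morP=> fU _ Uu; rewrite (subvP fU) ?memv_img. Qed.

Lemma morT X Y f v : f \in mor X Y -> f (oper X v) = oper Y (f v).
Proof. by case/morP=> _ /lfunP/(_ v); rewrite !comp_lfunE. Qed.

Lemma mor_iter X Y f m v : f \in mor X Y -> f (iter m (oper X) v) = iter m (oper Y) (f v).
Proof. by move=> mf; elim: m => //= m IH; rewrite (morT _ mf) IH. Qed.

Lemma mor1 X : \1 \in mor X X.
Proof. by apply: mor_intro => [u|v]; rewrite !id_lfunE. Qed.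

Lemma mor_comp X Y Z f g : f \in mor Y Z -> g \in mor X Y -> f \o g \in mor X Z.
Proof.
move=> mf mg; apply: mor_intro => [u Uu|v]; rewrite !comp_lfunE.
  exact/(morU mf)/(morU mg).
by rewrite (morT _ mg) (morT _ mf).
Qed.

Lemma morD X Y f g : f \in mor X Y -> g \in mor X Y -> f + g \in mor X Y.
Proof. exact: memvD. Qed.
Lemma morB X Y f g : f \in mor X Y -> g \in mor X Y -> f - g \in mor X Y.
Proof. exact: memvB. Qed.
Lemma morN X Y f : f \in mor X Y -> - f \in mor X Y.
Proof. by rewrite memvN. Qed.
Lemma mor0 X Y : 0 \in mor X Y. Proof. exact: mem0v. Qed.

Definition isom X Y (f : 'Hom(space X, space Y)) :=
  exists2 g, g \in mor Y X & (g \o f = \1) /\ (f \o g = \1).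

Lemma isomorphicP X Y : isomorphic X Y <-> exists2 f, f \in mor X Y & isom f.
Proof.
split=> [[f [g [/morP mf /morP mg gf fg]]]|[f /morP mf [g /morP mg [gf fg]]]].
  by exists f => //; exists g.
by exists f, g.
Qed.

Lemma isomorphic_sym X Y : isomorphic X Y -> isomorphic Y X.
Proof. by case=> f [g []]; exists g, f. Qed.

Lemma isomorphic_trans X Y Z : isomorphic X Y -> isomorphic Y Z -> isomorphic X Z.
Proof.
move=> /isomorphicP[f mf [f' mf' [f'f ff']]] /isomorphicP[g mg [g' mg' [g'g gg']]].
apply/isomorphicP; exists (g \o f); first exact: mor_comp mg mf.
exists (f' \o g'); first exact: mor_comp mf' mg'.
by rewrite -comp_lfunA (comp_lfunA g') g'g comp_lfun1l f'f comp_lfunA -(comp_lfunA g) ff'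
   comp_lfun1r gg'.
Qed.

Definition post X Y Z (f : 'Hom(space Y, space Z)) :
  'Hom('Hom(space X, space Y), 'Hom(space X, space Z)) := linfun (comp_lfun f).
Lemma postE X Y Z (f : 'Hom(space Y, space Z)) g : post X f g = f \o g.
Proof. by apply: linfunE => a u v; rewrite comp_lfunDr comp_lfunZr. Qed.

Definition pre X Y Z (f : 'Hom(space X, space Y)) :
  'Hom('Hom(space Y, space Z), 'Hom(space X, space Z)) := linfun (fun g => g \o f).
Lemma preE X Y Z (f : 'Hom(space X, space Y)) g : pre Z f g = g \o f.
Proof. by apply: linfunE => a u v; rewrite comp_lfunDl comp_lfunZl. Qed.

Definition injl Y Z : 'Hom(space Y, space (dsum Y Z)) := linfun (fun y => (y, 0)).
Definition injr Y Z : 'Hom(space Z, space (dsum Y Z)) := linfun (fun z => (0, z)).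
Definition prl Y Z : 'Hom(space (dsum Y Z), space Y) := linfun fst.
Definition prr Y Z : 'Hom(space (dsum Y Z), space Z) := linfun snd.

Lemma injlE Y Z y : injl Y Z y = (y, 0).
Proof. by apply: linfunE => a u v; congr pair; rewrite /= scaler0 addr0. Qed.
Lemma injrE Y Z z : injr Y Z z = (0, z).
Proof. by apply: linfunE => a u v; congr pair; rewrite /= scaler0 addr0. Qed.
Lemma prlE Y Z p : prl Y Z p = p.1. Proof. exact: lfunE. Qed.
Lemma prrE Y Z p : prr Y Z p = p.2. Proof. exact: lfunE. Qed.

Lemma injl_mor Y Z : injl Y Z \in mor Y (dsum Y Z).
Proof.
apply: mor_intro => [u Uu|v]; first by rewrite mem_dsum_subsp injlE Uu mem0v.
by rewrite !injlE dsum_operE linear0.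
Qed.
Lemma injr_mor Y Z : injr Y Z \in mor Z (dsum Y Z).
Proof.
apply: mor_intro => [u Uu|v]; first by rewrite mem_dsum_subsp injrE Uu mem0v.
by rewrite !injrE dsum_operE linear0.
Qed.
Lemma prl_mor Y Z : prl Y Z \in mor (dsum Y Z) Y.
Proof.
apply: mor_intro => [u|v]; first by rewrite mem_dsum_subsp prlE => /andP[].
by rewrite !prlE dsum_operE.
Qed.
Lemma prr_mor Y Z : prr Y Z \in mor (dsum Y Z) Z.
Proof.
apply: mor_intro => [u|v]; first by rewrite mem_dsum_subsp prrE => /andP[].
by rewrite !prrE dsum_operE.
Qed.

Lemma prl_injl Y Z : prl Y Z \o injl Y Z = \1.
Proof. by apply/lfunP => y; rewrite comp_lfunE injlE prlE id_lfunE. Qed.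
Lemma prr_injr Y Z : prr Y Z \o injr Y Z = \1.
Proof. by apply/lfunP => y; rewrite comp_lfunE injrE prrE id_lfunE. Qed.
Lemma prl_injr Y Z : prl Y Z \o injr Y Z = 0.
Proof. by apply/lfunP => y; rewrite comp_lfunE injrE prlE zero_lfunE. Qed.
Lemma prr_injl Y Z : prr Y Z \o injl Y Z = 0.
Proof. by apply/lfunP => y; rewrite comp_lfunE injlE prrE zero_lfunE. Qed.
Lemma inj_pr_sum Y Z : (injl Y Z \o prl Y Z) + (injr Y Z \o prr Y Z) = \1.
Proof.
apply/lfunP => -[y z]; rewrite add_lfunE !comp_lfunE prlE prrE injlE injrE id_lfunE.
by congr pair; rewrite ?addr0 ?add0r.
Qed.

(** Hom(Z, -) is additive: the two injections embed Hom(Z, X) and Hom(Z, Y) as complementary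
    subspaces. *)
Lemma dimHom_dsum Z X Y :
  \dim (mor Z (dsum X Y)) = (\dim (mor Z X) + \dim (mor Z Y))%N.
Proof.
have kl : (lker (post Z (injl X Y)) == 0)%VS.
  apply/lker0P => f g; rewrite !postE => /(congr1 (comp_lfun (prl X Y))).
  by rewrite !comp_lfunA prl_injl !comp_lfun1l.
have kr : (lker (post Z (injr X Y)) == 0)%VS.
  apply/lker0P => f g; rewrite !postE => /(congr1 (comp_lfun (prr X Y))).
  by rewrite !comp_lfunA prr_injr !comp_lfun1l.
rewrite -(limg_dim_eq (f := post Z (injl X Y)) (U := mor Z X)); last first.
  by rewrite (eqP kl) capv0.
rewrite -(limg_dim_eq (f := post Z (injr X Y)) (U := mor Z Y)); last first.
  by rewrite (eqP kr) capv0.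
rewrite -dimv_disjoint_sum; last first.
  apply/eqP; rewrite -subv0; apply/subvP => h; rewrite memv_cap memv0.
  case/andP=> /memv_imgP[f _ ->] /memv_imgP[g _]; rewrite !postE => e.
  move/(congr1 (comp_lfun (prl X Y))): (e).
  rewrite !comp_lfunA prl_injl prl_injr comp_lfun1l comp_lfun0l => ->.
  by rewrite comp_lfun0r.
congr (\dim _); apply/vspaceP => h; apply/idP/memv_addP => [mh|].
  exists (injl X Y \o (prl X Y \o h)).
    by rewrite -postE memv_img // (mor_comp (prl_mor _ _) mh).
  exists (injr X Y \o (prr X Y \o h)).
    by rewrite -postE memv_img // (mor_comp (prr_mor _ _) mh).
  by rewrite !comp_lfunA -comp_lfunDl inj_pr_sum comp_lfun1l.
case=> _ /memv_imgP[f mf ->] [_ /memv_imgP[g mg ->] ->]; rewrite !postE.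
by apply: morD; [apply: mor_comp (injl_mor _ _) mf | apply: mor_comp (injr_mor _ _) mg].
Qed.

Lemma dimHom_isol X Y Z : isomorphic X Y -> \dim (mor X Z) = \dim (mor Y Z).
Proof.
case/isomorphicP=> f mf [g mg [gf fg]].
have k0 : (lker (pre Z g) == 0)%VS.
  apply/lker0P => u v; rewrite !preE => /(congr1 (fun h => h \o f)).
  by rewrite -!comp_lfunA gf !comp_lfun1r.
rewrite -(limg_dim_eq (f := pre Z g) (U := mor X Z)) ?(eqP k0) ?capv0 //.
congr (\dim _); apply/vspaceP => h; apply/memv_imgP/idP => [[u mu ->]|mh].
  by rewrite preE; apply: mor_comp mu mg.
by exists (h \o f); [apply: mor_comp mh mf | rewrite preE -comp_lfunA fg comp_lfun1r].
Qed.

Lemma dimHom_isor X Y Z : isomorphic X Y -> \dim (mor Z X) = \dim (mor Z Y).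
Proof.
case/isomorphicP=> f mf [g mg [gf fg]].
have k0 : (lker (post Z f) == 0)%VS.
  apply/lker0P => u v; rewrite !postE => /(congr1 (comp_lfun g)).
  by rewrite !comp_lfunA gf !comp_lfun1l.
rewrite -(limg_dim_eq (f := post Z f) (U := mor Z X)) ?(eqP k0) ?capv0 //.
congr (\dim _); apply/vspaceP => h; apply/memv_imgP/idP => [[u mu ->]|mh].
  by rewrite postE; apply: mor_comp mf mu.
by exists (g \o h); [apply: mor_comp mg mh | rewrite postE comp_lfunA fg comp_lfun1l].
Qed.

(** A subobject of X carries the induced subspace, so that kernels in the category are
    kernels of linear maps; the last clause is their universal property. *)
Definition kernel_of X Y (h : 'Hom(space X, space Y)) Z (i : 'Hom(space Z, space X)) :=
  [/\ i \in mor Z X, lker i == 0%VS, h \o i = 0 &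
   forall W (c : 'Hom(space W, space X)), c \in mor W X -> h \o c = 0 ->
     exists2 d, d \in mor W Z & i \o d = c].

Section Kernel.
Variables (X Y : invSubspace k n) (h : 'Hom(space X, space Y)).
Hypothesis mh : h \in mor X Y.
Let K := lker h.
Let inc : 'Hom(subvs_of K, space X) := linfun vsval.
Let opK : 'End(subvs_of K) := linfun (fun v => vsproj K (oper X (vsval v))).

Let incE v : inc v = vsval v. Proof. exact: lfunE. Qed.
Let opKE v : vsval (opK v) = oper X (vsval v).
Proof.
rewrite linfunE; last by move=> a u w; rewrite !linearP.
rewrite vsprojK // memv_ker (morT _ mh); have := subvsP v.
by rewrite memv_ker => /eqP ->; rewrite linear0.
Qed.
Fact ker_nilp v : iter n opK v = 0.
Proof.
apply: val_inj => /=; have -> m : vsval (iter m opK v) = iter m (oper X) (vsval v).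
  by elim: m => //= m IH; rewrite opKE IH.
by rewrite oper_nilp.
Qed.
Fact ker_stable : (opK @: (inc @^-1: subsp X) <= inc @^-1: subsp X)%VS.
Proof.
apply/subvP => _ /memv_imgP[v + ->]; rewrite -!memv_preim !incE opKE => Uv.
by rewrite (subvP (oper_stable X)) ?memv_img.
Qed.
Definition kerobj := InvSubspace ker_nilp ker_stable.

Lemma kernel_exists :
  exists (Z : invSubspace k n) (i : 'Hom(space Z, space X)), kernel_of h i.
Proof.
exists kerobj, inc; split.
- by apply: mor_intro => [u|v] /=; rewrite -?memv_preim // !incE opKE.
- by apply/lker0P => u v; rewrite !incE; apply: val_inj.
- apply/lfunP => v; rewrite comp_lfunE zero_lfunE incE; apply/eqP.
  by rewrite -memv_ker; apply: subvsP.
move=> W c mc hc.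
have cK w : c w \in K.
  by rewrite memv_ker; move/lfunP/(_ w): hc; rewrite comp_lfunE zero_lfunE => ->.
pose d : 'Hom(space W, subvs_of K) := linfun (fun w => vsproj K (c w)).
have dE w : vsval (d w) = c w.
  by rewrite linfunE ?vsprojK // => a u v; rewrite !linearP.
exists d; last by apply/lfunP => w; rewrite comp_lfunE incE dE.
apply: mor_intro => [u Uu|v]; first by rewrite -memv_preim incE dE (morU mc).
by apply: val_inj => /=; rewrite opKE !dE (morT _ mc).
Qed.
End Kernel.

Definition nilpotent_end (V : vectType k) (f : 'End(V)) := exists m, forall v, iter m f v = 0.

(** The image of U is contained in U and has the same dimension, so the linear inverse
    preserves U as well. *)
Lemma isom_inj X (f : 'End(space X)) : f \in mor X X -> lker f == 0%VS -> isom f.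
Proof.
move=> mf kf; exists f^-1; last by rewrite lker0_compVf ?lker0_compfV.
have fU : (f @: subsp X = subsp X)%VS.
  apply/eqP; rewrite eqEdim; apply/andP; split.
    by apply/subvP => _ /memv_imgP[u Uu ->]; apply: morU.
  by rewrite limg_dim_eq // (eqP kf) capv0.
apply: mor_intro => [u|v].
  by rewrite -{1}fU => /memv_imgP[w Uw ->]; rewrite lker0_lfunK.
have /lker0P injf := kf; by apply: injf; rewrite (morT _ mf) !lker0_lfunVK.
Qed.

(** On a kernel vector f acts as the scalar - c, whose powers do not vanish. *)
Lemma inj_add_nilp (V : vectType k) (c : k) (f : 'End(V)) :
  c != 0 -> nilpotent_end f -> lker (c *: \1 + f) == 0%VS.
Proof.
move=> c0 [m fm]; rewrite -subv0; apply/subvP => v; rewrite memv_ker memv0.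
rewrite add_lfunE scale_lfunE id_lfunE addr_eq0 => /eqP cv.
have st j : iter j f v = (- c) ^+ j *: v.
  elim: j => [|j IH]; first by rewrite scale1r.
  rewrite iterS IH linearZ /= -[f v]opprK -cv -scaleNr scalerA -exprSr //.
by move/eqP: (fm v); rewrite st scaler_eq0 expf_eq0 oppr_eq0 (negbTE c0) andbF.
Qed.

Lemma nilpotent_swap (V W : vectType k) (p : 'Hom(V, W)) (q : 'Hom(W, V)) :
  nilpotent_end (q \o p) -> nilpotent_end (p \o q).
Proof.
case=> m qp; exists m.+1 => w.
have -> : iter m.+1 (p \o q)%VF w = p (iter m (q \o p)%VF (q w)).
  elim: m {qp} => [|m IH]; first by rewrite /= comp_lfunE.
  by rewrite iterS IH comp_lfunE iterS comp_lfunE.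
by rewrite qp linear0.
Qed.

End Morphisms.

(** * Direct summands of sums of listed objects *)

Lemma inj_comp_eq (k : fieldType) (U V W : vectType k) (i : 'Hom(V, W)) (f g : 'Hom(U, V)) :
  lker i == 0%VS -> i \o f = i \o g -> f = g.
Proof.
move=> /lker0P inji /lfunP e; apply/lfunP => u; apply: inji.
by have := e u; rewrite !comp_lfunE.
Qed.

Lemma comp_at (k : fieldType) (U V W : vectType k) (a : 'Hom(U, V)) (b : 'Hom(V, W)) c u :
  b \o a = c -> b (a u) = c u.
Proof. by move=> <-; rewrite comp_lfunE. Qed.

Lemma inj_sub_nilp (k : fieldType) (V : vectType k) (f : 'End(V)) :
  nilpotent_end f -> lker (\1 - f) == 0%VS.
Proof.
case=> m fm; rewrite -subv0; apply/subvP => v; rewrite memv_ker memv0.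
rewrite add_lfunE opp_lfunE id_lfunE subr_eq0 => /eqP ev.
have st j : iter j f v = v by elim: j => //= j ->.
by rewrite -(st m) fm.
Qed.

Section Retracts.
Variables (k : fieldType) (n : nat).
Implicit Types (Y Z W : invSubspace k n).

Lemma isom_sub_nilp Y (f : 'End(space Y)) : f \in mor Y Y -> nilpotent_end f -> isom (\1 - f).
Proof.
move=> mf nf; apply: isom_inj; last exact: inj_sub_nilp.
by apply: morB mf; apply: mor1.
Qed.

Lemma zeroP Y : \1 = 0 :> 'End(space Y) \/ nonzero Y.
Proof.
have [e|] := eqVneq (\1 : 'End(space Y)) 0; first by left.
by case/lfunPn=> u; rewrite id_lfunE zero_lfunE => u0; right; exists u.
Qed.

Lemma nonzero_id Y : nonzero Y -> \1 != 0 :> 'End(space Y).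
Proof. by case=> v v0; apply/lfunPn; exists v; rewrite id_lfunE zero_lfunE. Qed.

Lemma nonzero_iso Y Z : isomorphic Y Z -> nonzero Y -> nonzero Z.
Proof.
case/isomorphicP=> f mf [g mg [gf fg]] [v v0]; exists (f v).
by apply: contra v0 => /eqP fv; rewrite -[v]id_lfunE -gf comp_lfunE fv linear0.
Qed.

(** The complement of the summand X is the kernel of the retraction q. *)
Lemma split_iso X Y (q : 'Hom(space Y, space X)) (i : 'Hom(space X, space Y)) :
  q \in mor Y X -> i \in mor X Y -> q \o i = \1 ->
  exists2 Z, isomorphic Y (dsum X Z) &
    nonzero Z \/ isomorphic Y X.
Proof.
move=> mq mi qi; have [Z [j [mj kj qj uj]]] := kernel_exists mq.
have me : \1 - (i \o q) \in mor Y Y by apply: morB (mor1 _) (mor_comp mi mq).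
have [|r mr jr] := uj _ _ me.
  by rewrite comp_lfunDr comp_lfun1r comp_lfunNr comp_lfunA qi comp_lfun1l subrr.
have rj : r \o j = \1.
  apply: (inj_comp_eq kj); rewrite comp_lfunA jr comp_lfunDl comp_lfun1l comp_lfunNl.
  by rewrite -comp_lfunA qj comp_lfun0r subr0 comp_lfun1r.
have ri : r \o i = 0.
  apply: (inj_comp_eq kj); rewrite comp_lfunA jr comp_lfunDl comp_lfun1l comp_lfunNl.
  by rewrite -comp_lfunA qi comp_lfun1r subrr comp_lfun0r.
have eYd : isomorphic Y (dsum X Z).
  apply/isomorphicP.
  exists ((injl X Z \o q) + (injr X Z \o r)).
    by apply: morD; [apply: mor_comp (injl_mor _ _) mq|apply: mor_comp (injr_mor _ _) mr].
  exists ((i \o prl X Z) + (j \o prr X Z)).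
    by apply: morD; [apply: mor_comp mi (prl_mor _ _)|apply: mor_comp mj (prr_mor _ _)].
  split.
    apply/lfunP => y; rewrite comp_lfunE [in LHS]add_lfunE !comp_lfunE prlE prrE.
    rewrite add_lfunE !comp_lfunE injlE injrE /= addr0 add0r -!comp_lfunE jr.
    by rewrite add_lfunE opp_lfunE !comp_lfunE addrC subrK.
  apply/lfunP => -[x z]; rewrite comp_lfunE [in LHS]add_lfunE !comp_lfunE.
  rewrite add_lfunE !comp_lfunE prlE prrE /= !linearD /=.
  rewrite (comp_at _ qi) (comp_at _ qj) (comp_at _ ri).
  rewrite (comp_at _ rj) !id_lfunE !zero_lfunE !linear0 addr0 add0r injlE injrE.
  by congr pair; rewrite /= ?addr0 ?add0r.
exists Z => //; have [Z0|] := zeroP Z; last by left.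
right; apply/isomorphicP; exists q => //; exists i => //; split=> //.
apply/eqP; rewrite eq_sym -subr_eq0 -jr -[r]comp_lfun1l Z0 comp_lfun0l comp_lfun0r.
by [].
Qed.

Lemma indec_retract X Y (q : 'Hom(space Y, space X)) (i : 'Hom(space X, space Y)) :
  nonzero X -> indecomposable Y ->
  q \in mor Y X -> i \in mor X Y -> q \o i = \1 -> isomorphic Y X.
Proof.
move=> X0 [_ Yind] mq mi /(split_iso mq mi)[Z eY [Z0|//]].
by case: Yind; exists X, Z.
Qed.

End Retracts.

Section Add.
Variables (k : fieldType) (n : nat) (I : finType) (X : I -> invSubspace k n).
Implicit Types (A B Y Z W : invSubspace k n).

(** Membership in the additive closure of the X_i, in a form suited to induction: the
    identity of Y is a sum of maps factoring through listed objects, peeled off one at a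
    time, so that retracts of sums are included. *)
Inductive in_add : invSubspace k n -> Prop :=
| in_add0 Y : \1 = 0 :> 'End(space Y) -> in_add Y
| in_addS Y Z i (p : 'Hom(space (X i), space Y)) (q : 'Hom(space Y, space (X i)))
    (r : 'Hom(space Z, space Y)) (s : 'Hom(space Y, space Z)) :
    p \in mor (X i) Y -> q \in mor Y (X i) -> r \in mor Z Y -> s \in mor Y Z ->
    (p \o q) + (r \o s) = \1 -> in_add Z -> in_add Y.

Lemma in_add_retract Y Z (p : 'Hom(space Z, space Y)) (q : 'Hom(space Y, space Z)) :
  p \in mor Z Y -> q \in mor Y Z -> p \o q = \1 -> in_add Z -> in_add Y.
Proof.
move=> mp mq pq aZ; case: aZ p q mp mq pq => {Z}
    [Z Z0|Z Z' i p' q' r s mp' mq' mr ms e aZ'] p q mp mq pq.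
  by apply: in_add0; rewrite -pq -[q]comp_lfun1l Z0 comp_lfun0l comp_lfun0r.
apply: (in_addS (p := p \o p') (q := q' \o q) (r := p \o r) (s := s \o q)) aZ';
  try exact: mor_comp.
rewrite -!comp_lfunA -comp_lfunDr (comp_lfunA p') (comp_lfunA r) -comp_lfunDl e.
by rewrite comp_lfun1l.
Qed.

Lemma in_add_X i : in_add (X i).
Proof.
pose Z := X i.
have [Z' [j [mj kj h0 _]]] := kernel_exists (mor1 Z).
have Z0 : \1 = 0 :> 'End(space Z').
  by apply: (inj_comp_eq kj); rewrite comp_lfun1r comp_lfun0r -h0 comp_lfun1l.
apply: (@in_addS Z Z' i \1 \1 j 0); rewrite ?mor1 ?mor0 //; last exact: in_add0.
by rewrite comp_lfun0r addr0 comp_lfun1l.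
Qed.

Lemma in_add_dsum Y Z : in_add Y -> in_add Z -> in_add (dsum Y Z).
Proof.
move=> aY aZ; elim: aY => {Y} [Y Y0|Y Y' i p q r s mp mq mr ms e _ IH].
  apply: in_add_retract (injr_mor Y Z) (prr_mor Y Z) _ aZ.
  rewrite -inj_pr_sum -[X in _ = (X \o _) + _]comp_lfun1r Y0.
  by rewrite comp_lfun0r comp_lfun0l add0r.
pose R := (injl Y Z \o (r \o prl Y' Z)) + (injr Y Z \o prr Y' Z).
pose S := (injl Y' Z \o (s \o prl Y Z)) + (injr Y' Z \o prr Y Z).
have mR : R \in mor (dsum Y' Z) (dsum Y Z).
  apply: morD; first exact: mor_comp (injl_mor _ _) (mor_comp mr (prl_mor _ _)).
  exact: mor_comp (injr_mor _ _) (prr_mor _ _).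
have mS : S \in mor (dsum Y Z) (dsum Y' Z).
  apply: morD; first exact: mor_comp (injl_mor _ _) (mor_comp ms (prl_mor _ _)).
  exact: mor_comp (injr_mor _ _) (prr_mor _ _).
apply: (in_addS (mor_comp (injl_mor Y Z) mp) (mor_comp mq (prl_mor Y Z)) mR mS) IH.
apply/lfunP => -[y z]; rewrite [LHS]add_lfunE !comp_lfunE [R _]add_lfunE [S _]add_lfunE.
rewrite !comp_lfunE !prlE !prrE !injlE !injrE /= addr0 add0r id_lfunE.
move/lfunP/(_ y): e; rewrite add_lfunE !comp_lfunE id_lfunE => e.
by congr pair => /=; rewrite ?addr0 ?add0r.
Qed.

Lemma in_add_retract2 Y Z1 Z2 (p1 : 'Hom(space Z1, space Y)) (q1 : 'Hom(space Y, space Z1))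
    (p2 : 'Hom(space Z2, space Y)) (q2 : 'Hom(space Y, space Z2)) :
  p1 \in mor Z1 Y -> q1 \in mor Y Z1 -> p2 \in mor Z2 Y -> q2 \in mor Y Z2 ->
  (p1 \o q1) + (p2 \o q2) = \1 -> in_add Z1 -> in_add Z2 -> in_add Y.
Proof.
move=> mp1 mq1 mp2 mq2 e a1 a2.
apply: (in_add_retract (p := (p1 \o prl Z1 Z2) + (p2 \o prr Z1 Z2))
  (q := (injl Z1 Z2 \o q1) + (injr Z1 Z2 \o q2)) _ _ _ (in_add_dsum a1 a2)).
- by apply: morD; [apply: mor_comp mp1 (prl_mor _ _)|apply: mor_comp mp2 (prr_mor _ _)].
- by apply: morD; [apply: mor_comp (injl_mor _ _) mq1|apply: mor_comp (injr_mor _ _) mq2].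
rewrite -e; apply/lfunP => y; rewrite comp_lfunE [in LHS]add_lfunE !comp_lfunE prlE prrE.
by rewrite [in RHS]add_lfunE !add_lfunE !comp_lfunE injlE injrE /= addr0 add0r.
Qed.

(** Lifting along h can be tested on maps from listed objects, by composing with the pieces
    of the identity of W. *)
Lemma lift_in_add A B W (h : 'Hom(space A, space B)) (u : 'Hom(space W, space B)) :
  in_add W -> u \in mor W B ->
  (forall i c, c \in mor (X i) W -> exists2 d, d \in mor (X i) A & h \o d = u \o c) ->
  exists2 d, d \in mor W A & h \o d = u.
Proof.
move=> aW; elim: aW u => {W} [W W0|W Z i p q r s mp mq mr ms e _ IH] u mu hu.
  by exists 0; [exact: mor0|rewrite comp_lfun0r -[u]comp_lfun1r W0 comp_lfun0r].
have [d1 md1 e1] := hu _ _ mp.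
have [|j c mc|d2 md2 e2] := IH (u \o r); first exact: mor_comp mu mr.
  have [d md e'] := hu _ _ (mor_comp mr mc).
  by exists d; rewrite // e' comp_lfunA.
exists ((d1 \o q) + (d2 \o s)).
  by apply: morD; apply: mor_comp.
by rewrite comp_lfunDr !comp_lfunA e1 e2 -!comp_lfunA -comp_lfunDr e comp_lfun1r.
Qed.

Section Local.
Hypothesis X_loc : forall i f, f \in mor (X i) (X i) -> isom f \/ nilpotent_end f.

(** One peels off X_i: either Y -> X_i -> Y has a composite X_i -> Y -> X_i that is
    invertible, and X_i is a summand of Y, or this composite is nilpotent, the other part of
    the identity of Y is invertible, and Y is a retract of the remaining sum. *)
Lemma in_add_summand Z Y (p : 'Hom(space Z, space Y)) (q : 'Hom(space Y, space Z)) :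
  p \in mor Z Y -> q \in mor Y Z -> p \o q = \1 -> nonzero Y -> in_add Z ->
  exists i (a : 'Hom(space (X i), space Y)) (b : 'Hom(space Y, space (X i))),
    [/\ a \in mor (X i) Y, b \in mor Y (X i) & b \o a = \1].
Proof.
move=> mp mq pq Y0 aZ; elim: aZ Y p q mp mq pq Y0 => {Z}.
  move=> Z Z0 Y p q _ _ pq /nonzero_id/eqP[].
  by rewrite -pq -[q]comp_lfun1l Z0 comp_lfun0l comp_lfun0r.
move=> Z Z' i a b r s ma mb mr ms e _ IH Y p q mp mq pq Y0.
have mpa := mor_comp mp ma; have mbq := mor_comp mb mq.
have [[w mw [we ew]]|nil] := X_loc (mor_comp mbq mpa).
  exists i, (p \o a), (w \o (b \o q)); split=> //; first exact: mor_comp mw mbq.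
  by rewrite -comp_lfunA.
have [w mw [we ew]] := isom_sub_nilp (mor_comp mpa mbq) (nilpotent_swap nil).
apply: (IH Y (w \o (p \o r)) (s \o q)) => //.
- exact: mor_comp mw (mor_comp mp mr).
- exact: mor_comp ms mq.
have e1 : ((p \o a) \o (b \o q)) + ((p \o r) \o (s \o q)) = \1.
  by rewrite -pq -[q in RHS]comp_lfun1l -e comp_lfunDl comp_lfunDr !comp_lfunA.
rewrite -we -(comp_lfunA w); congr comp_lfun.
by rewrite -e1 addrC addKr.
Qed.

Hypothesis X_nz : forall i, nonzero (X i).

Lemma indec_in_add Y : in_add Y -> indecomposable Y -> exists i, isomorphic Y (X i).
Proof.
move=> aY Yind.
have [i [a [b [ma mb ba]]]] :=
  in_add_summand (mor1 Y) (mor1 Y) (comp_lfun1l _) Yind.1 aY.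
by exists i; apply: indec_retract mb ma ba.
Qed.

(** The idempotent attached to a decomposition is invertible or nilpotent, hence 1 or 0. *)
Lemma local_indec i : indecomposable (X i).
Proof.
split=> // -[Y [Z [Y0 Z0 /isomorphicP[f mf [g mg [gf fg]]]]]].
pose e := g \o (injl Y Z \o (prl Y Z \o f)).
have me : e \in mor (X i) (X i).
  exact: mor_comp mg (mor_comp (injl_mor _ _) (mor_comp (prl_mor _ _) mf)).
have fe : f \o e = injl Y Z \o (prl Y Z \o f) by rewrite /e comp_lfunA fg comp_lfun1l.
have ee : e \o e = e.
  by rewrite {1}/e -!comp_lfunA fe (comp_lfunA (prl Y Z) (injl Y Z)) prl_injl comp_lfun1l.
have [[w mw [we ew]]|[m nil]] := X_loc me.
  have e1 : e = \1 by rewrite -[e]comp_lfun1l -we -comp_lfunA ee.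
  case: Z0 => z /eqP[].
  move/(congr1 (comp_lfun (prr Y Z))): fe.
  rewrite e1 comp_lfun1r comp_lfunA prr_injl comp_lfun0l => f0.
  move/lfunP/(_ (g (0, z))): f0; rewrite comp_lfunE zero_lfunE -(comp_lfunE f) fg.
  by rewrite id_lfunE prrE.
case: Y0 => y /eqP[].
have fix_ j : iter j e (g (y, 0)) = g (y, 0).
  elim: j => //= j ->; rewrite !comp_lfunE -(comp_lfunE f) fg id_lfunE prlE injlE //.
have /(congr1 f) := nil (g (y, 0)); rewrite fix_ -comp_lfunE fg id_lfunE linear0.
by case.
Qed.

End Local.
End Add.

(** * Kernels of morphisms between sums of listed objects *)

Section Syzygy.
Variables (k : fieldType) (n : nat) (I : finType) (X : I -> invSubspace k n).
Implicit Types (A B Y Z W : invSubspace k n).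
Hypothesis X_loc : forall i f, f \in mor (X i) (X i) -> isom f \/ nilpotent_end f.

Variables (E K : I -> invSubspace k n).
Variables (g : forall i, 'Hom(space (E i), space (X i))).
Variables (a : forall i, 'Hom(space (K i), space (E i))).
Hypothesis mg : forall i, g i \in mor (E i) (X i).
Hypothesis ma : forall i, a i \in mor (K i) (E i).
Hypothesis ga : forall i, g i \o a i = 0.
Hypothesis a_ker : forall i W (c : 'Hom(space W, space (E i))), c \in mor W (E i) ->
  g i \o c = 0 -> exists2 d, d \in mor W (K i) & a i \o d = c.
Hypothesis aE : forall i, in_add X (E i).
Hypothesis aK : forall i, in_add X (K i).
Hypothesis g_lift : forall i j f, f \in mor (X i) (X j) ->
  isom f \/ exists2 s, s \in mor (X i) (E j) & g j \o s = f.
Hypothesis g_noniso : forall j c, c \in mor (X j) (E j) -> ~ isom (g j \o c).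

Definition img A B (h : 'Hom(space A, space B)) i := (post (X i) h @: mor (X i) A)%VS.

Lemma imgP A B (h : 'Hom(space A, space B)) i (u : 'Hom(space (X i), space B)) :
  reflect (exists2 d, d \in mor (X i) A & h \o d = u) (u \in img h i).
Proof.
apply: (iffP memv_imgP) => [[d md ->]|[d md <-]]; exists d; rewrite ?postE //.
Qed.

Lemma img_sub A B (h : 'Hom(space A, space B)) i : h \in mor A B -> (img h i <= mor (X i) B)%VS.
Proof. by move=> mh; apply/subvP => u /imgP[d md <-]; apply: mor_comp. Qed.

Lemma sum_dim_lt (V : I -> vectType k) (U W : forall i, {vspace V i}) j :
  (forall i, U i <= W i)%VS -> ~~ (W j <= U j)%VS ->
  (\sum_i \dim (U i) < \sum_i \dim (W i))%N.
Proof.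
move=> UW WUj; rewrite (bigD1 j) //= [X in (_ < X)%N](bigD1 j) //= -addSn.
apply: leq_add; last by apply: leq_sum => i _; apply: dimvS.
by rewrite ltn_neqAle dimvS ?dimv_leqif_sup // andbT -(dimv_leqif_sup (UW j)) in WUj *.
Qed.

(** This is a simple submodule of the cokernel of Hom(M, A) -> Hom(M, B), for M the sum of
    the X_i: among the maps outside the image, one takes m generating, together with the
    image, a submodule of least dimension. If m r were still outside the image for a radical
    map r, minimality would give m = h b + m r d, and 1 - r d is invertible. *)
Lemma socle A B (h : 'Hom(space A, space B)) : h \in mor A B ->
  forall j (m : 'Hom(space (X j), space B)), m \in mor (X j) B -> m \notin img h j ->
  exists j' (m' : 'Hom(space (X j'), space B)),
    [/\ m' \in mor (X j') B, m' \notin img h j' &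
       forall i c, c \in mor (X i) (E j') ->
         exists2 d, d \in mor (X i) A & h \o d = m' \o g j' \o c].
Proof.
move=> mh j m; pose nu j (m : 'Hom(space (X j), space B)) i := (img h i + img m i)%VS.
have [N] := ubnP (\sum_i \dim (nu j m i))%N.
elim: N j m => // N IH j m; rewrite ltnS => leN mm mh'.
have [all_ok|] := boolP [forall i, (img (m \o g j) i <= img h i)%VS].
  exists j, m; split=> // i c mc; move/forallP/(_ i)/subvP: all_ok => ok.
  by apply/imgP/ok/imgP; exists c => //; rewrite -comp_lfunA.
move/forallPn=> [i /subvPn[r0 r0im r0n]].
have /imgP[c mc cE] := r0im; rewrite -{}cE -comp_lfunA in r0n; move: r0n.
set r := g j \o c; move=> mr_notin.
have mr : r \in mor (X i) (X j) := mor_comp (mg j) mc.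
apply: (IH i (m \o r)) => //; last exact: mor_comp mm mr.
apply: leq_trans leN; apply: (sum_dim_lt (j := j)) => [l|].
  apply: addvS; first exact: subvv.
  by apply/subvP => u /imgP[d md <-]; apply/imgP; exists (r \o d);
    [exact: mor_comp mr md|rewrite comp_lfunA].
apply: contra mh' => /subvP/(_ m) mnu.
have /mnu/memv_addP[_ /imgP[b mb <-] [_ /imgP[d md <-] em]] : m \in nu j m j.
  rewrite -[m]add0r memv_add ?mem0v //; apply/imgP; exists \1; first exact: mor1.
  by rewrite comp_lfun1r add0r.
have mrd : r \o d \in mor (X j) (X j) := mor_comp mr md.
have [|nil] := X_loc mrd.
  by rewrite /r -comp_lfunA => /g_noniso[]; apply: mor_comp mc md.
have [w mw [we ew]] := isom_sub_nilp mrd nil.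
apply/imgP; exists (b \o w); first exact: mor_comp mb mw.
have -> : h \o (b \o w) = (m \o (\1 - (r \o d))) \o w.
  rewrite comp_lfunA; congr (comp_lfun _ _).
  rewrite comp_lfunDr comp_lfun1r comp_lfunNr comp_lfunA; apply/eqP.
  by rewrite eq_sym subr_eq -em.
by rewrite -comp_lfunA ew comp_lfun1r.
Qed.

(** Second syzygies over an algebra of global dimension 2 are projective. The induction is
    on the codimension of the image of Hom(M, A) in Hom(M, B), which drops when h is
    enlarged to (h, m) on A + X_j. *)
Theorem kernel_in_add A B (h : 'Hom(space A, space B)) Z (i : 'Hom(space Z, space A)) :
  in_add X A -> in_add X B -> h \in mor A B -> kernel_of h i -> in_add X Z.
Proof.
move=> aA aB mh.
have [N] := ubnP (\sum_i \dim (mor (X i) B) - \sum_i \dim (img h i))%N.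
elim: N A h aA mh Z i => // N IH A h aA mh Z kap; rewrite ltnS => leN [mk kk hk univ].
have [surj|] := boolP [forall i, (mor (X i) B <= img h i)%VS].
  have [j c mc|s ms hs] := lift_in_add (h := h) aB (mor1 B).
    by rewrite comp_lfun1l; apply/imgP; move/forallP/(_ j)/subvP: surj; apply.
  have [||r mr kr] := univ A (\1 - (s \o h)).
  - by apply: morB (mor1 _) (mor_comp ms mh).
  - by rewrite comp_lfunDr comp_lfunNr comp_lfunA hs comp_lfun1l comp_lfun1r subrr.
  apply: in_add_retract mr mk _ aA; apply: (inj_comp_eq kk).
  rewrite comp_lfunA kr comp_lfunDl comp_lfun1l comp_lfunNl -comp_lfunA hk.
  by rewrite comp_lfun0r subr0 comp_lfun1r.
move/forallPn=> [j0 /subvPn[m0 mm0 m0h]].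
have {j0 m0 mm0 m0h}[j [m [mm mh' mg_lift]]] := socle mh mm0 m0h.
(* By the choice of m, its composite with g_j : E_j -> X_j factors as h s. *)
have [//|s ms hs] := lift_in_add (h := h) (aE j) (mor_comp mm (mg j)).
pose A' := dsum A (X j).
pose h' : 'Hom(space A', space B) := (h \o prl A (X j)) + (m \o prr A (X j)).
have mh'' : h' \in mor A' B.
  exact: morD (mor_comp mh (prl_mor _ _)) (mor_comp mm (prr_mor _ _)).
have h'l : h' \o injl A (X j) = h.
  by rewrite comp_lfunDl -!comp_lfunA prl_injl prr_injl comp_lfun0r addr0 comp_lfun1r.
have h'r : h' \o injr A (X j) = m.
  by rewrite comp_lfunDl -!comp_lfunA prl_injr prr_injr comp_lfun0r add0r comp_lfun1r.
have [Z' [kap' kerZ']] := kernel_exists mh''.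
have lt_img : (\sum_i \dim (img h i) < \sum_i \dim (img h' i))%N.
  apply: (sum_dim_lt (j := j)) => [l|].
    apply/subvP => u /imgP[d md <-]; apply/imgP; exists (injl A (X j) \o d).
      exact: mor_comp (injl_mor _ _) md.
    by rewrite comp_lfunA h'l.
  apply: contra mh' => /subvP; apply; apply/imgP; exists (injr A (X j)) => //.
  exact: injr_mor.
have aZ' : in_add X Z'.
  apply: (IH A' h' _ mh'' Z' kap' _ kerZ'); first by apply: in_add_dsum aA (in_add_X _ _).
  apply: leq_trans leN; apply: (ltn_sub2l (leq_trans lt_img _) lt_img).
  by apply: leq_sum => l _; apply/dimvS/img_sub.
case: kerZ' => mk' kk' hk' univ'.
pose pl := prl A (X j) \o kap'; pose pr := prr A (X j) \o kap'.
have mpl : pl \in mor Z' A := mor_comp (prl_mor _ _) mk'.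
have mpr : pr \in mor Z' (X j) := mor_comp (prr_mor _ _) mk'.
have hpl : (h \o pl) + (m \o pr) = 0 by rewrite -hk' comp_lfunDl -!comp_lfunA.
(* An isomorphism X_l -> Z' -> X_j would let m factor through h, so the projection pr of Z'
   to X_j lifts to t : Z' -> E_j. *)
have [l c mc|t mt gt] := lift_in_add (h := g j) aZ' mpr.
  have [[w mw [we ew]]|//] := g_lift (mor_comp mpr mc).
  case/negP: mh'; apply/imgP; exists (- (pl \o (c \o w))).
    exact: morN (mor_comp mpl (mor_comp mc mw)).
  have hplE : h \o pl = - (m \o pr) by apply/eqP; rewrite -addr_eq0 hpl.
  rewrite comp_lfunNr comp_lfunA hplE comp_lfunNl opprK -comp_lfunA (comp_lfunA pr).
  by rewrite ew comp_lfun1r.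
(* The pair (- s, g_j) is killed by h', whence E_j -> Z'; the map Z' -> Z below splits the
   inclusion up to a map factoring through K_j. *)
have [phi mphi kphi] : exists2 phi, phi \in mor (E j) Z' &
    kap' \o phi = (injr A (X j) \o g j) - (injl A (X j) \o s).
  apply: univ'.
    exact: morB (mor_comp (injr_mor _ _) (mg j)) (mor_comp (injl_mor _ _) ms).
  by rewrite comp_lfunDr comp_lfunNr !comp_lfunA h'l h'r hs subrr.
have plphi : pl \o phi = - s.
  rewrite -comp_lfunA kphi comp_lfunDr comp_lfunNr !comp_lfunA prl_injl prl_injr.
  by rewrite comp_lfun0l comp_lfun1l add0r.
have prphi : pr \o phi = g j.
  rewrite -comp_lfunA kphi comp_lfunDr comp_lfunNr !comp_lfunA prr_injl prr_injr.
  by rewrite comp_lfun0l comp_lfun1l subr0.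
have [inc minc kinc] : exists2 inc, inc \in mor Z Z' & kap' \o inc = injl A (X j) \o kap.
  apply: univ'; first by apply: mor_comp (injl_mor _ _) mk.
  by rewrite comp_lfunA h'l.
have plinc : pl \o inc = kap by rewrite -comp_lfunA kinc comp_lfunA prl_injl comp_lfun1l.
have princ : pr \o inc = 0 by rewrite -comp_lfunA kinc comp_lfunA prr_injl comp_lfun0l.
have [b mb ab] : exists2 b, b \in mor Z (K j) & a j \o b = t \o inc.
  by apply: a_ker; [exact: mor_comp mt minc|rewrite comp_lfunA gt].
have [rho mrho krho] : exists2 rho, rho \in mor Z' Z & kap \o rho = pl - (pl \o (phi \o t)).
  apply: univ.
    exact: morB mpl (mor_comp mpl (mor_comp mphi mt)).
  rewrite comp_lfunDr comp_lfunNr.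
  have hplE : h \o pl = - (m \o pr) by apply/eqP; rewrite -addr_eq0 hpl.
  by rewrite (comp_lfunA h pl) hplE !comp_lfunNl -comp_lfunA (comp_lfunA pr) prphi gt subrr.
have [sig msig ksig] : exists2 sig, sig \in mor (K j) Z & kap \o sig = - (s \o a j).
  apply: univ; first by apply: morN; apply: mor_comp ms (ma j).
  by rewrite comp_lfunNr comp_lfunA hs -comp_lfunA ga comp_lfun0r oppr0.
apply: (in_add_retract2 mrho minc msig mb) aZ' (aK j).
apply: (inj_comp_eq kk); rewrite comp_lfun1r comp_lfunDr (comp_lfunA kap rho) krho.
rewrite (comp_lfunA kap sig) ksig comp_lfunDl comp_lfunNl plinc comp_lfunNl -(comp_lfunA s) ab.
rewrite -(comp_lfunA pl) -(comp_lfunA phi) (comp_lfunA pl phi) plphi comp_lfunNl opprK.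
by rewrite addrK.
Qed.
End Syzygy.

(** * Every object is a kernel of a map between sums of injective objects *)

Lemma sep_functionals (k : fieldType) (V : vectType k) (W : {vspace V}) :
  exists s : seq 'Hom(V, k^o),
    (forall l w, l \in s -> w \in W -> l w = 0) /\
    (forall v, (forall l, l \in s -> l v = 0) -> v \in W).
Proof.
pose l i : 'Hom(V, k^o) := linfun (fun v => coord (vbasis {:V}) i (v - projv W v) : k^o).
have lE i v : l i v = coord (vbasis {:V}) i (v - projv W v).
  apply: linfunE => c u w; rewrite linearP opprD addrACA -scalerBr linearP //.
exists [seq l i | i <- enum 'I_(\dim {:V})]; split=> [_ w /mapP[i _ ->] Ww|v lv].
  by rewrite lE projv_id // subrr linear0.
have : v - projv W v = 0.
  rewrite (coord_vbasis (memvf (v - projv W v))) big1 // => i _.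
  by rewrite -lE lv ?scale0r // map_f // mem_enum.
by move/subr0_eq ->; apply: memv_proj.
Qed.

Section Cogeneration.
Variables (k : fieldType) (n : nat) (I : finType) (X : I -> invSubspace k n).
Implicit Types (A B Y Z W : invSubspace k n).
Hypothesis inj_full : forall Y (l : 'Hom(space Y, k^o)),
  exists i (q : 'Hom(space Y, space (X i))), q \in mor Y (X i) /\
    forall v, q v = 0 <-> forall m, l (iter m (oper Y) v) = 0.
Hypothesis inj_null : forall Y (l : 'Hom(space Y, k^o)),
  (forall u, u \in subsp Y -> l u = 0) ->
  exists i (q : 'Hom(space Y, space (X i))), q \in mor Y (X i) /\
    forall v, q v \in subsp (X i) -> l v = 0.

Lemma in_add_inhabited Y : exists A, in_add X A.
Proof.
have [Z [j [mj kj h0 _]]] := kernel_exists (mor1 Y).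
exists Z; apply: in_add0; apply: (inj_comp_eq kj).
by rewrite comp_lfun1r comp_lfun0r -h0 comp_lfun1l.
Qed.

(** A functional l is turned by [inj_full] into a morphism killing the largest submodule on
    which l vanishes. *)
Lemma functionals_full Y (s : seq 'Hom(space Y, k^o)) :
  exists A (f : 'Hom(space Y, space A)), [/\ in_add X A, f \in mor Y A &
    forall v, f v = 0 <-> forall l m, l \in s -> l (iter m (oper Y) v) = 0].
Proof.
elim: s => [|l s [A [f [aA mf fE]]]].
  have [A aA] := in_add_inhabited Y; exists A, 0; split=> //; first exact: mor0.
  by move=> v; rewrite zero_lfunE.
have [i [q [mq qE]]] := inj_full l.
exists (dsum (X i) A), ((injl (X i) A \o q) + (injr (X i) A \o f)); split.
- by apply: in_add_dsum => //; apply: in_add_X.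
- exact: morD (mor_comp (injl_mor _ _) mq) (mor_comp (injr_mor _ _) mf).
move=> v; rewrite add_lfunE !comp_lfunE injlE injrE; split.
  case; rewrite /= addr0 add0r => /qE ql /fE fl l' m; rewrite inE => /predU1P[->//|].
  exact: fl.
move=> H; congr pair; rewrite /= ?addr0 ?add0r.
  by apply/qE => m; apply: H; rewrite mem_head.
by apply/fE => l' m sl; apply: H; rewrite inE sl orbT.
Qed.

Lemma functionals_null Y (s : seq 'Hom(space Y, k^o)) :
  (forall l u, l \in s -> u \in subsp Y -> l u = 0) ->
  exists A (f : 'Hom(space Y, space A)), [/\ in_add X A, f \in mor Y A &
    forall v, f v \in subsp A -> forall l, l \in s -> l v = 0].
Proof.
elim: s => [|l s IH] sU.
  have [A aA] := in_add_inhabited Y; exists A, 0; split=> //; exact: mor0.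
have [|A [f [aA mf fE]]] := IH.
  by move=> l' u sl; apply: sU; rewrite inE sl orbT.
have [|i [q [mq qE]]] := @inj_null Y l.
  by move=> u; apply: sU; rewrite mem_head.
exists (dsum (X i) A), ((injl (X i) A \o q) + (injr (X i) A \o f)); split.
- by apply: in_add_dsum => //; apply: in_add_X.
- exact: morD (mor_comp (injl_mor _ _) mq) (mor_comp (injr_mor _ _) mf).
move=> v; rewrite add_lfunE !comp_lfunE injlE injrE mem_dsum_subsp /= addr0 add0r.
by case/andP=> /qE lv /fE fl l'; rewrite inE => /predU1P[->//|]; apply: fl.
Qed.

(** Functionals on the whole space make the map injective, and those vanishing on U detect
    membership in U. *)
Lemma embed Y : exists A (f : 'Hom(space Y, space A)),
  [/\ in_add X A, f \in mor Y A, lker f == 0%VS & forall v, f v \in subsp A -> v \in subsp Y].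
Proof.
have [s1 [_ s1P]] := sep_functionals (0%VS : {vspace space Y}).
have [s2 [s2U s2P]] := sep_functionals (subsp Y).
have [A1 [f1 [aA1 mf1 f1E]]] := functionals_full s1.
have [A2 [f2 [aA2 mf2 f2E]]] := functionals_null s2U.
exists (dsum A1 A2), ((injl A1 A2 \o f1) + (injr A1 A2 \o f2)); split.
- exact: in_add_dsum.
- exact: morD (mor_comp (injl_mor _ _) mf1) (mor_comp (injr_mor _ _) mf2).
- rewrite -subv0; apply/subvP => v; rewrite memv_ker add_lfunE !comp_lfunE injlE injrE.
  case/andP=> /= + _; rewrite addr0 => /eqP/f1E f1v.
  by apply: s1P => l sl; apply: (f1v l 0%N).
move=> v; rewrite add_lfunE !comp_lfunE injlE injrE mem_dsum_subsp /= add0r.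
by case/andP=> _ /f2E f2v; apply: s2P.
Qed.

(** After embedding Y into A, the functionals on A vanishing on Y define a second map whose
    kernel is Y: since Y is stable under T, a functional killing Y kills it along all powers
    of T. *)
Lemma kernel_presentation Y : exists A B (f : 'Hom(space Y, space A)) (h : 'Hom(space A, space B)),
  [/\ in_add X A, in_add X B, h \in mor A B & kernel_of h f].
Proof.
have [A [f [aA mf kf fU]]] := embed Y.
have [s [s0 sP]] := sep_functionals (limg f).
have [B [h [aB mh hE]]] := functionals_full s.
exists A, B, f, h; split=> //; split=> //.
  apply/lfunP => y; rewrite comp_lfunE zero_lfunE; apply/hE => l m sl.
  by rewrite -(mor_iter _ _ mf) (s0 _ _ sl) // memv_img ?memvf.
move=> W c mc hc.
have cf w : f (f^-1 (c w)) = c w.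
  apply: limg_lfunVK; apply: sP => l sl.
  have /hE H : h (c w) = 0 by rewrite (comp_at _ hc) zero_lfunE.
  exact: (H l 0%N).
have /lker0P injf := kf.
exists (f^-1 \o c); last by apply/lfunP => w; rewrite !comp_lfunE cf.
apply: mor_intro => [u Uu|v]; rewrite !comp_lfunE.
  by apply: fU; rewrite cf (morU mc).
by apply: injf; rewrite cf (morT _ mc) (morT _ mf) cf.
Qed.

End Cogeneration.

(** * Classification from dimensions of morphism spaces *)

Section Classification.
Variables (k : fieldType) (n : nat) (I : finType) (X : I -> invSubspace k n).
Implicit Types (A B Y Z W : invSubspace k n).
Hypothesis X_nz : forall i, nonzero (X i).
Hypothesis X_scalar : forall i (f : 'End(space (X i))), f \in mor (X i) (X i) ->
  exists c, nilpotent_end (f - c *: \1).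
Hypothesis inj_full : forall Y (l : 'Hom(space Y, k^o)),
  exists i (q : 'Hom(space Y, space (X i))), q \in mor Y (X i) /\
    forall v, q v = 0 <-> forall m, l (iter m (oper Y) v) = 0.
Hypothesis inj_null : forall Y (l : 'Hom(space Y, k^o)),
  (forall u, u \in subsp Y -> l u = 0) ->
  exists i (q : 'Hom(space Y, space (X i))), q \in mor Y (X i) /\
    forall v, q v \in subsp (X i) -> l v = 0.

Variables (E K : I -> invSubspace k n).
Variables (g : forall i, 'Hom(space (E i), space (X i))).
Variables (a : forall i, 'Hom(space (K i), space (E i))).
Hypothesis mg : forall i, g i \in mor (E i) (X i).
Hypothesis ker_g : forall i, kernel_of (g i) (a i).
Hypothesis aE : forall i, in_add X (E i).
Hypothesis aK : forall i, in_add X (K i).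
Hypothesis dim_eq : forall i j,
  (\dim (mor (X i) (E j)) + (i == j) = \dim (mor (X i) (X j)) + \dim (mor (X i) (K j)))%N.

(** End(X_i) is the scalars plus nilpotent endomorphisms, hence local. *)
Lemma scalar_loc i f : f \in mor (X i) (X i) -> isom f \/ nilpotent_end f.
Proof.
move=> mf; have [c nil] := X_scalar mf.
have [c0|c0] := eqVneq c 0; first by right; move: nil; rewrite c0 scale0r subr0.
left; apply: isom_inj => //.
by rewrite -[f](subrK (c *: \1)) addrC inj_add_nilp.
Qed.

(** Left exactness of Hom(X_i, -) turns the dimension count into the size of the space of
    maps that factor through g_j: everything for i <> j, a hyperplane for i = j. *)
Lemma dim_img i j :
  (\dim (post (X i) (g j) @: mor (X i) (E j)) + (i == j) = \dim (mor (X i) (X j)))%N.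
Proof.
have [ma ka ga univ] := ker_g j.
apply/eqP; rewrite -(eqn_add2r (\dim (mor (X i) (K j)))) -dim_eq addnAC eqn_add2r addnC.
rewrite -(limg_ker_dim (post (X i) (g j))) eqn_add2r; apply/eqP.
rewrite -(limg_dim_eq (f := post (X i) (a j))); last first.
  apply/eqP; rewrite -subv0; apply/subvP => u; rewrite memv_cap memv_ker memv0 postE.
  case/andP=> _ /eqP au; apply/eqP/(inj_comp_eq ka); by rewrite au comp_lfun0r.
congr (\dim _); apply/vspaceP => u; rewrite memv_cap memv_ker postE.
apply/memv_imgP/andP => [[d md ->]|[mu /eqP gu]].
  rewrite postE; split; first exact: mor_comp ma md.
  by rewrite comp_lfunA ga comp_lfun0l.
by have [d md <-] := univ _ _ mu gu; exists d; rewrite ?postE.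
Qed.

(** The maps factoring through g_j form a right ideal; containing the identity, it would be
    all of End(X_j) instead of a hyperplane. *)
Lemma id_notin_img j : \1 \notin (post (X j) (g j) @: mor (X j) (E j))%VS.
Proof.
apply/negP => /memv_imgP[s ms]; rewrite postE => e.
have := dim_img j j; rewrite eqxx; set P := (_ @: _)%VS => dimP.
have : (mor (X j) (X j) <= P)%VS.
  apply/subvP => f mf; apply/memv_imgP; exists (s \o f); first exact: mor_comp ms mf.
  by rewrite postE comp_lfunA -e comp_lfun1l.
by move/dimvS; rewrite -dimP addn1 ltnn.
Qed.

Lemma comp_noniso j c : c \in mor (X j) (E j) -> ~ isom (g j \o c).
Proof.
move=> mc [w mw [_ ew]]; case/negP: (id_notin_img j); apply/memv_imgP.
by exists (c \o w); [exact: mor_comp mc mw|rewrite postE comp_lfunA ew].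
Qed.

(** For i = j the endomorphisms through g_j form a hyperplane complementary to the scalars;
    a nilpotent endomorphism has no scalar part with respect to it, as otherwise its other
    part would be invertible. *)
Lemma almost_split i j f : f \in mor (X i) (X j) ->
  isom f \/ exists2 s, s \in mor (X i) (E j) & g j \o s = f.
Proof.
have := dim_img i j; have := id_notin_img j; set P := (_ @: _)%VS.
have liftP f' : f' \in (post (X i) (g j) @: mor (X i) (E j))%VS ->
    exists2 s, s \in mor (X i) (E j) & g j \o s = f'.
  by case/memv_imgP=> s ms ->; exists s; rewrite ?postE.
have sP : (post (X i) (g j) @: mor (X i) (E j) <= mor (X i) (X j))%VS.
  by apply/subvP => _ /memv_imgP[s ms ->]; rewrite postE; apply: mor_comp (mg j) ms.
have [eij|nij] := eqVneq i j; last first.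
  move=> _; rewrite addn0 => dimP mf; right; apply: liftP.
  suff -> : (post (X i) (g j) @: mor (X i) (E j) = mor (X i) (X j))%VS by [].
  by apply/eqP; rewrite eqEdim sP dimP leqnn.
subst i => nid dimP mf; have [|nil] := scalar_loc mf; first by left.
right; apply: (liftP); rewrite -/P in sP *.
have : (f \in P + <[\1]>)%VS.
  suff <- : (mor (X j) (X j) = P + <[\1]>)%VS by [].
  apply/eqP; rewrite eq_sym eqEdim subv_add sP -memvE mor1 /= dimv_disjoint_sum.
    by rewrite dim_vline -dimP nonzero_id.
  apply/eqP; rewrite -subv0; apply/subvP => u; rewrite memv_cap memv0.
  case/andP=> Pu /vlineP[c eu]; have [c0|c0] := eqVneq c 0; first by rewrite eu c0 scale0r.
  by case/negP: nid; rewrite -[\1](scalerK c0) -eu memvZ.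
case/memv_addP=> u Pu [_ /vlineP[c ->] ef].
have [c0|c0] := eqVneq c 0; first by rewrite ef c0 scale0r addr0.
have mu := subvP sP _ Pu.
have [s ms es] := liftP _ Pu.
case: (comp_noniso ms); rewrite es; apply: isom_inj => //.
have -> : u = (- c) *: \1 + f by rewrite ef scaleNr addrC addrK.
by apply: inj_add_nilp => //; rewrite oppr_eq0.
Qed.

Theorem all_in_add Y : in_add X Y.
Proof.
have [A [B [f [h [aA aB mh kf]]]]] := kernel_presentation inj_full inj_null Y.
have ma i : a i \in mor (K i) (E i) by case: (ker_g i).
have ga i : g i \o a i = 0 by case: (ker_g i).
have ua i W (c : 'Hom(space W, space (E i))) : c \in mor W (E i) -> g i \o c = 0 ->
    exists2 d, d \in mor W (K i) & a i \o d = c.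
  by case: (ker_g i) => _ _ _; apply.
exact: (kernel_in_add scalar_loc mg ma ga ua aE aK almost_split comp_noniso aA aB mh kf).
Qed.

(** The identity [dim_eq] for the pair (i, i) fails when the first index is replaced by
    another one, so that X_i and X_j have different dimensions of Hom for i <> j. *)
Theorem classification :
  [/\ forall i, indecomposable (X i),
      forall i j, isomorphic (X i) (X j) -> i = j &
      forall Y, indecomposable Y -> exists i, isomorphic Y (X i)].
Proof.
split=> [i|i j iso|Y].
- exact: local_indec scalar_loc X_nz i.
- apply/eqP; apply: contraT => nij; have := dim_eq i i; have := dim_eq j i.
  rewrite !(dimHom_isol _ iso) eqxx [j == i]eq_sym (negbTE nij) addn0 => ->.
  by move/eqP; rewrite -[X in _ == X]addn0 eqn_add2l.
exact: indec_in_add scalar_loc X_nz Y (all_in_add Y).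
Qed.

End Classification.

Local Close Scope lfun_scope.

(** * Objects given by integer matrices *)

Definition table := seq (seq int).
Definition ent (M : table) i j : int := nth 0%Z (nth [::] M i) j.
Definition tab d e (F : nat -> nat -> int) : table :=
  [seq [seq F i j | j <- iota 0 e] | i <- iota 0 d].
(** Sparse notation for matrices with entries 0, 1 and -1: a row is the list of its non-zero
    columns, counted from 1 and signed by the entry. *)
Definition signed d e (rows : table) : table :=
  tab d e (fun i j => let r := nth [::] rows i in
    if Posz j.+1 \in r then 1%Z else if Negz j \in r then (-1)%Z else 0%Z).
(** Entries of matrix products, with the integer operations named directly so that they
    reduce without unfolding the ring structure of the integers. *)
Definition mulf m (A B : table) i j : int :=
  foldr (fun l s => intZmod.addz (intRing.mulz (ent A i l) (ent B l j)) s) 0%Z (iota 0 m).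
Definition eqf d e (F G : nat -> nat -> int) : bool :=
  all (fun i => all (fun j => F i j == G i j) (iota 0 e)) (iota 0 d).
Definition idf i j : int := if i == j :> nat then 1%Z else 0%Z.

(** An object on row vectors: tm is the matrix of T acting on the right, and U is spanned by
    the basis vectors whose mask is true. *)
Record dobj := DObj { dim : nat; mask : seq bool; tm : table }.
Definition inU X i := nth false (mask X) i.

Definition maskb X Y (M : table) :=
  eqf (dim X) (dim Y) (fun i j => if inU X i && ~~ inU Y j then ent M i j else 0%Z)
    (fun _ _ => 0%Z).

Definition zobj := DObj 0 [::] [::].
Definition csum X Y := DObj (dim X + dim Y)
  [seq if (i < dim X)%N then inU X i else inU Y (i - dim X) | i <- iota 0 (dim X + dim Y)]
  (tab (dim X + dim Y) (dim X + dim Y) (fun i j =>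
     if (i < dim X)%N then (if (j < dim X)%N then ent (tm X) i j else 0%Z)
     else (if (j < dim X)%N then 0%Z else ent (tm Y) (i - dim X) (j - dim X)))).

Definition powt n d (T : table) : table :=
  iter n (fun M => tab d d (mulf d M T)) (tab d d idf).

Lemma nth_map_iota T (x0 : T) (f : nat -> T) n i : (i < n)%N -> nth x0 (map f (iota 0 n)) i = f i.
Proof. by move=> lt; rewrite (nth_map 0%N) ?size_iota // nth_iota ?add0n. Qed.

Lemma ent_tab d e F i j : (i < d)%N -> (j < e)%N -> ent (tab d e F) i j = F i j.
Proof. by move=> id je; rewrite /ent /tab nth_map_iota // nth_map_iota. Qed.

Lemma eqfP d e F G :
  reflect (forall i j, (i < d)%N -> (j < e)%N -> F i j = G i j) (eqf d e F G).
Proof.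
apply: (iffP allP) => [H i j id je|H i].
  have := H i; rewrite mem_iota /= add0n => /(_ id)/allP/(_ j).
  by rewrite mem_iota /= add0n => /(_ je)/eqP.
by rewrite mem_iota /= add0n => id; apply/allP => j; rewrite mem_iota /= add0n => je; rewrite H.
Qed.

Section Realize.
Variable k : fieldType.

Definition mxz d e (M : table) : 'M[k]_(d, e) := \matrix_(i, j) (ent M i j)%:~R.
Definition lmx d e (M : 'M[k]_(d, e)) : 'Hom('rV[k]_d, 'rV[k]_e) := linfun (mulmxr M).

Lemma lmxE d e (M : 'M[k]_(d, e)) v : lmx M v = v *m M. Proof. exact: lfunE. Qed.

Lemma lmx_lin1 d e (f : 'Hom('rV[k]_d, 'rV[k]_e)) : f = lmx (lin1_mx f).
Proof. by apply/lfunP => v; rewrite lmxE mul_rV_lin1. Qed.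

Lemma lmx_inj d e : injective (@lmx d e).
Proof.
move=> M N /lfunP e'; apply/row_matrixP => i; rewrite !rowE.
by have := e' (delta_mx 0 i); rewrite !lmxE.
Qed.

Lemma lmx_comp d e f (M : 'M[k]_(d, e)) (N : 'M[k]_(e, f)) :
  (lmx N \o lmx M)%VF = lmx (M *m N).
Proof. by apply/lfunP => v; rewrite comp_lfunE !lmxE mulmxA. Qed.

Lemma mxz_mulf d m e A B : mxz d m A *m mxz m e B = \matrix_(i, j) (mulf m A B i j)%:~R.
Proof.
apply/matrixP => i j; rewrite !mxE /mulf.
have -> s : foldr (fun l s => intZmod.addz (intRing.mulz (ent A i l) (ent B l j)) s) 0%Z s
    = \sum_(l <- s) ent A i l * ent B l j.
  by elim: s => [|l s IH] /=; rewrite ?big_nil // big_cons -IH.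
rewrite rmorph_sum /= (_ : iota 0 m = index_iota 0 m) ?big_mkord; last first.
  by rewrite /index_iota subn0.
by apply: eq_bigr => l _; rewrite !mxE rmorphM.
Qed.

Lemma mxz_tab d e F : mxz d e (tab d e F) = \matrix_(i, j) (F i j)%:~R.
Proof. by apply/matrixP => i j; rewrite !mxE ent_tab. Qed.

Definition opm X : 'M[k]_(dim X) := mxz (dim X) (dim X) (tm X).

(** The common kernel of the coordinates outside the mask. *)
Definition maskU X : {vspace 'rV[k]_(dim X)} :=
  lker (lmx (diag_mx (\row_i (~~ inU X i)%:R))).

Lemma maskUP X (v : 'rV[k]_(dim X)) :
  reflect (forall i : 'I_(dim X), ~~ inU X i -> v 0 i = 0) (v \in maskU X).
Proof.
have E i : (lmx (diag_mx (\row_i (~~ inU X i)%:R)) v) 0 i = v 0 i * (~~ inU X i)%:R.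
  rewrite lmxE mxE (bigD1 i) //= big1 ?addr0 => [|j ji]; last first.
    by rewrite !mxE (negbTE ji) mulr0n mulr0.
  by rewrite !mxE eqxx mulr1n.
rewrite memv_ker; apply: (iffP eqP) => [/rowP H i ni|H].
  by have := H i; rewrite E ni mulr1 mxE.
by apply/rowP => i; rewrite E mxE; case: (boolP (inU X i)) => [_|/H ->]; rewrite ?mulr0 ?mul0r.
Qed.

(** In bases adapted to the subspaces, mapping U into U' is the vanishing of a block. *)
Definition stays_in X Y (M : 'M[k]_(dim X, dim Y)) :=
  forall (i : 'I_(dim X)) (j : 'I_(dim Y)), inU X i -> ~~ inU Y j -> M i j = 0.

Lemma stays_inP X Y (M : 'M[k]_(dim X, dim Y)) :
  stays_in M <-> forall u, u \in maskU X -> u *m M \in maskU Y.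
Proof.
split=> [H u /maskUP Uu|H i j Ui Uj].
  apply/maskUP => j nj; rewrite mxE big1 // => i _.
  by case: (boolP (inU X i)) => [Ui|/Uu ->]; rewrite ?mul0r // H ?mulr0.
have /maskUP/(_ j Uj) : delta_mx 0 i *m M \in maskU Y.
  apply: H; apply/maskUP => l nl; rewrite mxE eqxx /=.
  by case: eqVneq nl => // ->; rewrite Ui.
by rewrite -rowE mxE.
Qed.

Definition good n X :=
  (forall v, iter n (lmx (opm X)) v = 0) /\ stays_in (opm X).

Fact good_stable n X : good n X -> (lmx (opm X) @: maskU X <= maskU X)%VS.
Proof.
case=> _ /stays_inP H; apply/subvP => _ /memv_imgP[u Uu ->]; rewrite lmxE; exact: H.
Qed.

Definition realize n X (h : good n X) : invSubspace k n :=
  InvSubspace (proj1 h) (good_stable h).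

Section Hom.
Variables (n : nat) (X Y : dobj) (hX : good n X) (hY : good n Y).

Lemma lmx_mor (M : 'M[k]_(dim X, dim Y)) :
  (lmx M \in mor (realize hX) (realize hY)) <-> stays_in M /\ opm X *m M = M *m opm Y.
Proof.
split=> [mM|[MU MT]].
  split; first by apply/stays_inP => u Uu; have := morU mM Uu; rewrite lmxE.
  apply: lmx_inj; rewrite -!lmx_comp; apply/lfunP => v; rewrite !comp_lfunE.
  exact: (@morT _ _ (realize hX) (realize hY) _ v mM).
apply: mor_intro => [u Uu|v]; first by rewrite lmxE; move/stays_inP: MU; apply.
by rewrite /= !lmxE -!mulmxA MT.
Qed.
End Hom.

Lemma maskb_stays X Y M : maskb X Y M -> @stays_in X Y (mxz (dim X) (dim Y) M).
Proof.
move/eqfP=> H i j Ui Uj; have := H i j (ltn_ord i) (ltn_ord j).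
by rewrite Ui Uj mxE /= => ->.
Qed.

Lemma iter_powt n d (T : table) (v : 'rV[k]_d) :
  iter n (lmx (mxz d d T)) v = v *m mxz d d (powt n d T).
Proof.
elim: n => [|n IH].
  rewrite /powt /= mxz_tab -[LHS]mulmx1; congr (_ *m _); apply/matrixP => i j.
  by rewrite !mxE /idf -val_eqE; case: eqP.
by rewrite !iterS IH lmxE -mulmxA mxz_mulf mxz_tab.
Qed.

Lemma good_check n X :
  eqf (dim X) (dim X) (ent (powt n (dim X) (tm X))) (fun _ _ => 0%Z) ->
  maskb X X (tm X) -> good n X.
Proof.
move=> /eqfP nilT mT; split; last exact: maskb_stays.
move=> v; rewrite iter_powt; suff -> : mxz (dim X) (dim X) (powt n (dim X) (tm X)) = 0.
  by rewrite mulmx0.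
by apply/matrixP => i j; rewrite !mxE nilT.
Qed.

Section Csum.
Variables (X Y : dobj).
Notation dX := (dim X).
Notation dY := (dim Y).

Lemma inU_csuml (i : 'I_dX) : inU (csum X Y) (lshift dY i) = inU X i.
Proof. by rewrite /inU /= nth_map_iota ?ltn_ord //= ltn_addr. Qed.
Lemma inU_csumr (i : 'I_dY) : inU (csum X Y) (rshift dX i) = inU Y i.
Proof. by rewrite /inU /= nth_map_iota ?ltn_add2l // ltnNge leq_addr /= addKn. Qed.

Lemma opm_csum : opm (csum X Y) = block_mx (opm X) 0 0 (opm Y).
Proof.
rewrite /opm /= mxz_tab; apply/matrixP => i j; rewrite mxE.
case: (split_ordP i) => i' ->; case: (split_ordP j) => j' -> /=.
- by rewrite block_mxEul mxE.
- by rewrite block_mxEur mxE.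
- by rewrite block_mxEdl mxE.
by rewrite block_mxEdr mxE !addKn.
Qed.

Lemma maskU_csum (u : 'rV[k]_dX) (v : 'rV[k]_dY) :
  (row_mx u v \in maskU (csum X Y)) = (u \in maskU X) && (v \in maskU Y).
Proof.
apply/maskUP/andP => [H|[/maskUP Hu /maskUP Hv] i].
  split; apply/maskUP => i ni.
    by have := H (lshift dY i); rewrite inU_csuml row_mxEl; apply.
  by have := H (rshift dX i); rewrite inU_csumr row_mxEr; apply.
case: (split_ordP i) => i' ->; first by rewrite inU_csuml row_mxEl; apply: Hu.
by rewrite inU_csumr row_mxEr; apply: Hv.
Qed.

Lemma lmx_csum (u : 'rV[k]_dX) (v : 'rV[k]_dY) :
  lmx (opm (csum X Y)) (row_mx u v) = row_mx (lmx (opm X) u) (lmx (opm Y) v).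
Proof. by rewrite !lmxE opm_csum mul_row_block !mulmx0 addr0 add0r. Qed.

Lemma good_csum n : good n X -> good n Y -> good n (csum X Y).
Proof.
case=> nX uX [nY uY]; split=> [w|].
  rewrite -[w]hsubmxK; have -> m u v : iter m (lmx (opm (csum X Y))) (row_mx u v)
      = row_mx (iter m (lmx (opm X)) u) (iter m (lmx (opm Y)) v).
    by elim: m => //= m ->; rewrite lmx_csum.
  by rewrite nX nY row_mx0.
move/stays_inP: uX => uX; move/stays_inP: uY => uY; apply/stays_inP => w.
rewrite -[w]hsubmxK -lmxE lmx_csum !maskU_csum !lmxE.
by case/andP=> /uX -> /uY ->.
Qed.

Lemma csum_iso n (hX : good n X) (hY : good n Y) (hXY : good n (csum X Y)) :
  isomorphic (realize hXY) (dsum (realize hX) (realize hY)).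
Proof.
pose f : 'Hom('rV[k]_(dX + dY), ('rV[k]_dX * 'rV[k]_dY)%type) :=
  linfun (fun w => (lsubmx w, rsubmx w)).
pose g : 'Hom(('rV[k]_dX * 'rV[k]_dY)%type, 'rV[k]_(dX + dY)) :=
  linfun (fun p => row_mx p.1 p.2).
have fE w : f w = (lsubmx w, rsubmx w).
  by apply: linfunE => c u v; rewrite !linearP.
have gE p : g p = row_mx p.1 p.2.
  by apply: linfunE => c u v; rewrite scale_row_mx add_row_mx.
apply/isomorphicP; exists f.
  apply: mor_intro => [w|w].
    by rewrite mem_dsum_subsp fE /= -{1}[w]hsubmxK maskU_csum.
  by rewrite dsum_operE !fE /= -{1 2}[w]hsubmxK lmx_csum row_mxKl row_mxKr.
exists g.
  apply: mor_intro => [p|p]; first by rewrite mem_dsum_subsp gE maskU_csum.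
  by rewrite !gE dsum_operE /= lmx_csum.
split; apply/lfunP => w; rewrite comp_lfunE id_lfunE.
  by rewrite fE gE hsubmxK.
by rewrite gE fE row_mxKl row_mxKr; case: w.
Qed.
End Csum.

Lemma good_zobj n : good n zobj.
Proof. by split=> [v|[]//]; apply/rowP => -[]. Qed.

End Realize.

(** * Dimensions of morphism spaces by elimination over the integers *)

(** A sparse linear form in the entries (a, b) of an unknown matrix, with strictly
    increasing positions in lexicographic order whenever it is produced by elimination. *)
Definition equation := seq ((nat * nat) * int).

Fixpoint ncmp (m n : nat) : comparison :=
  match m, n with
  | 0, 0 => Eq | 0, _ => Lt | _, 0 => Gt
  | m'.+1, n'.+1 => ncmp m' n'
  end.
Definition vcmp (v w : nat * nat) : comparison :=
  match ncmp v.1 w.1 with Eq => ncmp v.2 w.2 | c => c end.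
Definition ltv v w := if vcmp v w is Lt then true else false.

Lemma ncmpP m n : match ncmp m n with Eq => m = n | Lt => (m < n)%N | Gt => (n < m)%N end.
Proof. by elim: m n => [|m IH] [|n] //=; have := IH n; case: ncmp => // ->. Qed.

Lemma vcmp_eq v w : vcmp v w = Eq -> v = w.
Proof.
case: v w => [a b] [c d]; rewrite /vcmp /=; have := ncmpP a c; have := ncmpP b d.
by case: ncmp; case: ncmp => // -> ->.
Qed.

Lemma ltvE v w : ltv v w = (v.1 < w.1)%N || (v.1 == w.1) && (v.2 < w.2)%N.
Proof.
case: v w => [a b] [c d]; rewrite /ltv /vcmp /=; have := ncmpP a c; have := ncmpP b d.
case: (ncmp a c) => [H ->|_ ->|H]; rewrite ?ltnn ?eqxx //=; last first.
  by move=> lt; rewrite ltnNge (ltnW lt) gtn_eqF.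
by move: H; case: ncmp => [->|->|/ltnW]; rewrite ?ltnn // leqNgt => /negbTE.
Qed.

Lemma ltv_trans : transitive ltv.
Proof.
move=> [c d] [a b] [e f]; rewrite !ltvE /= => /orP[ac|/andP[/eqP-> bd]].
  case/orP=> [ce|/andP[/eqP <- _]]; first by rewrite (ltn_trans ac ce).
  by rewrite ac.
by case/orP=> [->//|/andP[-> df]]; rewrite (ltn_trans bd df) orbT.
Qed.

Lemma ltv_neq v w : ltv v w -> w != v.
Proof. by rewrite ltvE; apply: contraTneq => ->; rewrite !ltnn andbF. Qed.

Fixpoint add_eqn (c : int) (r : equation) : equation -> equation :=
  match r with
  | [::] => fun q => [seq (t.1, intRing.mulz c t.2) | t <- q]
  | (v, x) :: r' => fix add_to q := match q with
    | [::] => (v, x) :: r'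
    | (w, y) :: q' => match vcmp v w with
      | Lt => (v, x) :: add_eqn c r' q
      | Gt => (w, intRing.mulz c y) :: add_to q'
      | Eq => let z := intZmod.addz x (intRing.mulz c y) in
              if z == 0%Z then add_eqn c r' q' else (v, z) :: add_eqn c r' q'
      end
    end
  end.

(** Subtracts multiples of the pivot rows of P, whose leading positions increase, and files
    the remainder at its place. Each step preserves the space of solutions, and [echelon]
    checks the shape of the final result. *)
Fixpoint insert (P : seq equation) (r : equation) : seq equation :=
  match r, P with
  | [::], _ => P
  | _, [::] => [:: r]
  | (v, x) :: _, q :: P' => match q with
    | [::] => insert P' r
    | (w, y) :: _ => match vcmp v w with
      | Lt => r :: P
      | Gt => q :: insert P' r
      | Eq => q :: insert P' (add_eqn (intZmod.oppz (intRing.mulz x y)) r q)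
      end
    end
  end.

Definition reduce (eqs : seq equation) := foldr (fun r P => insert P r) [::] eqs.

(** The pivots 1 and -1 make this an echelon form over every field at once. *)
Fixpoint echelon d e (P : seq equation) : bool :=
  if P is q :: P' then
    (if q is (v, y) :: q' then
       [&& (y == 1%Z) || (y == (-1)%Z), (v.1 < d)%N, (v.2 < e)%N,
           path ltv v [seq t.1 | t <- q'] &
           if P' is ((w, _) :: _) :: _ then ltv v w else true]
     else false) && echelon d e P'
  else true.

Definition sparse_row X a : seq (nat * int) :=
  [seq t <- [seq (c, ent (tm X) a c) | c <- iota 0 (dim X)] | t.2 != 0%Z].
Definition sparse_col Y b : seq (nat * int) :=
  [seq t <- [seq (c, ent (tm Y) c b) | c <- iota 0 (dim Y)] | t.2 != 0%Z].
Definition comm_eqn a b (ra cb : seq (nat * int)) : equation :=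
  foldr (fun t r => add_eqn 1%Z [:: t] r) [::]
    ([seq ((t.1, b), t.2) | t <- ra] ++ [seq ((a, t.1), intZmod.oppz t.2) | t <- cb]).
Definition mask_eqns X Y : seq equation :=
  [seq [:: (v, 1%Z)] | v <- [seq (a, b) | a <- iota 0 (dim X), b <- iota 0 (dim Y)]
     & inU X v.1 && ~~ inU Y v.2].
(** The equations on a matrix M saying that M maps U into U' and that T M = M T'. *)
Definition mor_eqns X Y : seq equation :=
  let cols := [seq (b, sparse_col Y b) | b <- iota 0 (dim Y)] in
  mask_eqns X Y ++
  flatten [seq (let ra := sparse_row X a in [seq comm_eqn a bc.1 ra bc.2 | bc <- cols])
          | a <- iota 0 (dim X)].
Definition hdim X Y : option nat :=
  let P := reduce (mor_eqns X Y) in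
  if echelon (dim X) (dim Y) P then Some (dim X * dim Y - size P)%N else None.

(** The equations of lower triangular matrices with constant diagonal. *)
Definition triangular_eqns d : seq equation :=
  [seq [:: (v, 1%Z)] | v <- [seq (a, b) | a <- iota 0 d, b <- iota 0 d] & (v.1 < v.2)%N] ++
  [seq [:: ((0, 0), 1%Z); ((a, a), (-1)%Z)] | a <- iota 1 d.-1].
(** Inserting an equation that follows from those of P leaves P unchanged. *)
Definition scalar_check X : bool :=
  let P := reduce (mor_eqns X X) in
  (0 < dim X)%N && all (fun r => insert P r == P) (triangular_eqns (dim X)).

Arguments add_eqn : simpl never.

Section Solutions.
Variables (k : fieldType) (d e : nat).
Notation hom := 'Hom('rV[k]_d, 'rV[k]_e).
Implicit Types (f : hom) (r q : equation) (P : seq equation).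

(** The entry (a, b) of the matrix of f, extended by zero outside the matrix so that
    positions are plain natural numbers. *)
Definition coef f a b : k :=
  \sum_(j < e) (f (\row_i ((i : nat) == a)%:R) 0 j) *+ (j == b :> nat).

Lemma coefP a b c f g : coef (c *: f + g) a b = c * coef f a b + coef g a b.
Proof.
rewrite /coef mulr_sumr -big_split /=; apply: eq_bigr => j _.
by rewrite add_lfunE scale_lfunE !mxE mulrnDl mulrnAr.
Qed.

Lemma coefE f (i : 'I_d) (j : 'I_e) : coef f i j = f (delta_mx 0 i) 0 j.
Proof.
rewrite /coef (bigD1 j) //= eqxx mulr1n big1 ?addr0 => [|l lj]; last first.
  by rewrite -[_ == _ :> nat]/(l == j) (negbTE lj) mulr0n.
by congr (f _ 0 j); apply/rowP => l; rewrite !mxE.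
Qed.

Definition evalr f r : k := \sum_(t <- r) t.2%:~R * coef f t.1.1 t.1.2.

Lemma evalr_linear r : linear (fun f => evalr f r : k^o).
Proof.
move=> c f g; rewrite /evalr scaler_sumr -big_split /=; apply: eq_bigr => t _.
by rewrite coefP mulrDr /GRing.scale /= mulrCA.
Qed.

Lemma evalr_cons f v x r : evalr f ((v, x) :: r) = x%:~R * coef f v.1 v.2 + evalr f r.
Proof. by rewrite /evalr big_cons. Qed.
Lemma evalr_nil f : evalr f [::] = 0. Proof. by rewrite /evalr big_nil. Qed.

Lemma evalr_add f c r q : evalr f (add_eqn c r q) = evalr f r + c%:~R * evalr f q.
Proof.
elim: r q => [|[v x] r IH] q.
  rewrite /= evalr_nil add0r /evalr big_map mulr_sumr; apply: eq_bigr => t _ /=.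
  by rewrite (rmorphM _ c) mulrA.
elim: q => [|[w y] q IHq]; first by rewrite evalr_nil mulr0 addr0.
have -> : add_eqn c ((v, x) :: r) ((w, y) :: q) = match vcmp v w with
      | Lt => (v, x) :: add_eqn c r ((w, y) :: q)
      | Gt => (w, intRing.mulz c y) :: add_eqn c ((v, x) :: r) q
      | Eq => let z := intZmod.addz x (intRing.mulz c y) in
              if z == 0%Z then add_eqn c r q else (v, z) :: add_eqn c r q
      end by [].
case cvw: vcmp => /=.
- have <- := vcmp_eq cvw.
  have zE : (intZmod.addz x (intRing.mulz c y))%:~R = x%:~R + c%:~R * y%:~R :> k.
    by rewrite (rmorphD _ x) (rmorphM _ c).
  have -> : evalr f (if intZmod.addz x (intRing.mulz c y) == 0 then add_eqn c r q else
      (v, intZmod.addz x (intRing.mulz c y)) :: add_eqn c r q) =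
      (intZmod.addz x (intRing.mulz c y))%:~R * coef f v.1 v.2 + evalr f (add_eqn c r q).
    by case: eqP => [->|_]; rewrite ?evalr_cons // mul0r add0r.
  rewrite zE IH !evalr_cons mulrDl mulrDr !mulrA -!addrA; congr (_ + _).
  by rewrite addrCA.
- by rewrite !evalr_cons IH !evalr_cons addrA.
rewrite !evalr_cons IHq !evalr_cons (rmorphM _ c) /= mulrDr mulrA.
by rewrite addrCA.
Qed.

Definition sat f P := forall r, r \in P -> evalr f r = 0.

Lemma sat_cons f r P : sat f (r :: P) <-> evalr f r = 0 /\ sat f P.
Proof.
split=> [H|[H0 H] q]; last by rewrite inE => /predU1P[->//|]; apply: H.
by split=> [|q qP]; apply: H; rewrite inE ?eqxx ?qP ?orbT.
Qed.

Lemma sat_insert f P r : sat f (insert P r) <-> evalr f r = 0 /\ sat f P.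
Proof.
elim: P r => [|q P IH] [|[v x] r] //=.
- by rewrite evalr_nil; split=> [|[]].
- exact: sat_cons.
- by rewrite evalr_nil; split=> [|[]].
case: q => [|[w y] q].
  rewrite IH sat_cons evalr_nil; tauto.
case cvw: vcmp; rewrite !sat_cons ?IH ?sat_cons ?evalr_add; try tauto.
split=> [[e1 [e2 e3]]|[e1 [e2 e3]]].
  by move: e2; rewrite e1 mulr0 addr0 => ->.
by rewrite e1 e2 mulr0 addr0.
Qed.

Lemma sat_reduce f P : sat f (reduce P) <-> sat f P.
Proof. by elim: P => //= r P IH; rewrite sat_insert sat_cons IH. Qed.

Definition form r : 'Hom(hom, k^o) := linfun (fun f => evalr f r : k^o).
Lemma formE r f : form r f = evalr f r. Proof. exact: (linfunE (evalr_linear r)). Qed.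

Fixpoint Sol P : {vspace hom} := if P is r :: P' then (lker (form r) :&: Sol P')%VS else fullv.

Lemma SolP P f : f \in Sol P <-> sat f P.
Proof.
elim: P => [|r P IH] /=; first by rewrite memvf.
rewrite memv_cap memv_ker formE sat_cons -IH; split=> [/andP[/eqP]|[-> ->]] //.
by rewrite eqxx.
Qed.

(** The functional is onto the base field on W, as it does not vanish at w. *)
Lemma dim_cap_functional (V : vectType k) (W : {vspace V}) (l : 'Hom(V, k^o)) w :
  w \in W -> l w != 0 -> (\dim (lker l :&: W)).+1 = \dim W.
Proof.
move=> Ww lw; rewrite -(limg_ker_dim l W) capvC -addn1; congr (_ + _)%N.
apply/eqP; rewrite eqn_leq; apply/andP; split.
  rewrite lt0n dimv_eq0; apply: contra lw => /eqP l0.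
  by rewrite -memv0 -l0 memv_img.
by apply: leq_trans (dimvS (subvf _)) _; rewrite dimvf.
Qed.

Lemma echelon_lead P v y q : echelon d e (((v, y) :: q) :: P) ->
  forall r t, r \in P -> t \in r -> ltv v t.1.
Proof.
elim: P v y q => // -[|[w z] r0] P IH v y q; first by rewrite /= andbF.
move=> /= /andP[/and5P[_ _ _ _ vw]] ech r t.
have /andP[/and5P[_ _ _ pw _] _] := ech.
have all_r0 : forall u, u \in (w, z) :: r0 -> ltv v u.1.
  move=> u; rewrite inE => /predU1P[->//|ur].
  apply: ltv_trans vw _; have := order_path_min ltv_trans pw.
  by move/allP; apply; apply: map_f.
rewrite inE => /predU1P[->|rP tr]; first exact: all_r0.
exact: ltv_trans vw (IH _ _ _ ech r t rP tr).
Qed.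

Lemma coef_delta (i : 'I_d) (j : 'I_e) a b :
  coef (lmx (delta_mx i j)) a b = ((a == i) && (b == j))%:R.
Proof.
rewrite /coef (bigD1 j) //= big1 ?addr0 => [|l lj]; last first.
  by rewrite lmxE mxE big1 ?mul0rn // => m _; rewrite !mxE (negbTE lj) andbF mulr0.
rewrite lmxE mxE (bigD1 i) //= big1 ?addr0 => [|l li]; last first.
  by rewrite !mxE (negbTE li) mulr0.
rewrite !mxE !eqxx mulr1 [(i : nat) == a]eq_sym [(j : nat) == b]eq_sym.
by case: (a == i :> nat); case: (b == j :> nat); rewrite /= ?mulr1n ?mulr0n ?mul0rn.
Qed.

(** The matrix unit at the leading position of the first row solves all later rows, which
    only involve larger positions, but not the first one: each row cuts the dimension by
    exactly 1. *)
Lemma dim_Sol P : echelon d e P -> (\dim (Sol P) + size P = d * e)%N.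
Proof.
elim: P => [|q P IH] ech.
  by rewrite /= addn0 dimvf; change (1 * d * (1 * e) = d * e)%N; rewrite !mul1n.
case: q ech => [//|[v y] q] ech; have lead := echelon_lead ech.
move: ech => /= /andP[/and5P[y1 vd ve pq _] echP].
rewrite addnS -addSn -(IH echP); congr (_ + _)%N.
pose D : hom := lmx (delta_mx (Ordinal vd) (Ordinal ve)).
have cD w : coef D w.1 w.2 = (w == v)%:R.
  by rewrite coef_delta /=; case: w v vd ve {lead pq D} => [a b] [c d'] /= _ _.
have zero r : (forall t, t \in r -> t.1 != v) -> evalr D r = 0.
  move=> H; rewrite /evalr big_seq big1 // => t tr.
  by rewrite cD (negbTE (H t tr)) mulr0.
apply: (@dim_cap_functional _ _ _ D).
  by apply/SolP => r rP; apply: zero => t tr; apply: ltv_neq (lead r t rP tr).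
rewrite formE evalr_cons cD eqxx mulr1 zero ?addr0.
  by case/orP: y1 => /eqP ->; rewrite ?oner_eq0 // oppr_eq0 oner_eq0.
move=> t tq; apply: ltv_neq; have := order_path_min ltv_trans pq.
by move/allP; apply; apply: map_f.
Qed.

End Solutions.

Lemma big_iota (R : nmodType) m (F : nat -> R) :
  \sum_(l <- iota 0 m) F l = \sum_(l < m) F l.
Proof. by rewrite -{1}[m]subn0 -/(index_iota 0 m) big_mkord. Qed.

Section MorEquations.
Variables (k : fieldType) (n : nat) (X Y : dobj).
Hypotheses (hX : good k n X) (hY : good k n Y).
Notation dX := (dim X).
Notation dY := (dim Y).
Implicit Types f : 'Hom('rV[k]_dX, 'rV[k]_dY).

Lemma sum_nz (s : seq (nat * int)) (F : nat -> k) :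
  \sum_(t <- s | t.2 != 0%Z) t.2%:~R * F t.1 = \sum_(t <- s) t.2%:~R * F t.1.
Proof.
rewrite big_mkcond; apply: eq_bigr => t _; case: eqP => // ->.
by rewrite mul0r.
Qed.

Lemma evalr_comm f (i : 'I_dX) (j : 'I_dY) (M := lin1_mx f) :
  evalr f (comm_eqn i j (sparse_row X i) (sparse_col Y j)) =
  (opm k X *m M) i j - (M *m opm k Y) i j.
Proof.
have -> a b ra cb : evalr f (comm_eqn a b ra cb) = evalr f
    ([seq ((t.1, b), t.2) | t <- ra] ++ [seq ((a, t.1), intZmod.oppz t.2) | t <- cb]).
  rewrite /comm_eqn; elim: (_ ++ _) => [|t s IH] //=.
  by rewrite evalr_add IH mul1r {1}/evalr big_seq1 /evalr big_cons.
rewrite /evalr big_cat !big_map !big_filter; congr (_ + _).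
  rewrite (sum_nz _ (fun c => coef f c j)) big_map big_iota mxE.
  by apply: eq_bigr => l _; rewrite coefE !mxE.
rewrite (eq_bigr (fun t => - (t.2%:~R * coef f i t.1))) => [|t _]; last first.
  by rewrite (rmorphN _ t.2) mulNr.
rewrite sumrN (sum_nz _ (fun c => coef f i c)) big_map big_iota mxE; congr (- _).
by apply: eq_bigr => l _; rewrite coefE !mxE mulrC.
Qed.

Lemma sat_mor f : sat f (mor_eqns X Y) <-> f \in mor (realize hX) (realize hY).
Proof.
rewrite [X in _ <-> is_true (X \in _)]lmx_lin1 lmx_mor; set M := lin1_mx f.
have ME (i : 'I_dX) (j : 'I_dY) : coef f i j = M i j by rewrite coefE mxE.
split=> [H|[HU HT] r].
  split=> [i j Ui Uj|].
    rewrite -ME; suff : evalr f [:: ((i : nat, j : nat), 1%Z)] = 0.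
      by rewrite /evalr big_seq1 mul1r.
    apply: H; rewrite mem_cat map_f // mem_filter Ui Uj /=.
    by apply/allpairsP; exists (i : nat, j : nat); rewrite !mem_iota !ltn_ord.
  apply/matrixP => i j; apply/eqP; rewrite -subr_eq0 -evalr_comm; apply/eqP/H.
  rewrite mem_cat; apply/orP; right; apply/flattenP.
  eexists; first by apply: map_f; rewrite mem_iota /= add0n; apply: (ltn_ord i).
  apply/mapP; exists (j : nat, sparse_col Y j) => //.
  by apply: map_f; rewrite mem_iota /= add0n.
rewrite mem_cat => /orP[/mapP[[a b]]|/flattenP[s /mapP[a]]].
  rewrite mem_filter => /andP[/andP[Ua Ub] /allpairsP[[a' b'] /= []]].
  rewrite !mem_iota /= !add0n => la lb [ea eb] ->; subst a' b'.
  rewrite /evalr big_seq1 mul1r.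
  by rewrite (ME (Ordinal la) (Ordinal lb)) HU.
rewrite mem_iota /= add0n => la -> /mapP[[b cb] /mapP[b']].
rewrite mem_iota /= add0n => lb [-> ->] -> /=.
by rewrite (evalr_comm f (Ordinal la) (Ordinal lb)) HT subrr.
Qed.

Lemma hdimP h : hdim X Y = Some h -> \dim (mor (realize hX) (realize hY)) = h.
Proof.
rewrite /hdim; case: ifP => // ech [<-].
have <- := dim_Sol k ech; rewrite addnK; congr (\dim _); apply/vspaceP => f.
by apply/idP/idP => [/sat_mor H|/SolP/sat_reduce/sat_mor //]; apply/SolP/sat_reduce.
Qed.

End MorEquations.

Section Scalar.
Variables (k : fieldType) (n : nat) (X : dobj) (hX : good k n X).

(** Minus its diagonal value, an endomorphism is strictly triangular: each application
    shortens the support of a vector by one coordinate. *)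
Lemma scalar_checkP (f : 'Hom('rV[k]_(dim X), 'rV[k]_(dim X))) : scalar_check X ->
  f \in mor (realize hX) (realize hX) -> exists c, nilpotent_end (f - c *: \1%VF).
Proof.
case/andP=> d0 /allP chk /sat_mor/sat_reduce sf.
have ext r : r \in triangular_eqns (dim X) -> evalr f r = 0.
  move=> rt; have /eqP e := chk r rt.
  by have /sat_insert[] : sat f (insert (reduce (mor_eqns X X)) r) by rewrite e.
pose M := lin1_mx f.
have ME (i j : 'I_(dim X)) : coef f i j = M i j by rewrite coefE mxE.
have upper (i j : 'I_(dim X)) : (i < j)%N -> M i j = 0.
  move=> ij; have /ext : [:: ((i : nat, j : nat), 1%Z)] \in triangular_eqns (dim X).
    rewrite mem_cat map_f // mem_filter ij /=.
    by apply/allpairsP; exists (i : nat, j : nat); rewrite !mem_iota !ltn_ord.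
  by rewrite /evalr big_seq1 mul1r ME.
pose o := Ordinal d0; pose c := M o o.
have diag (i : 'I_(dim X)) : M i i = c.
  have [->//|i0] := eqVneq i o.
  have /ext : [:: ((0, 0), 1%Z); ((i : nat, i : nat), (-1)%Z)] \in triangular_eqns (dim X).
    rewrite mem_cat; apply/orP; right; apply/mapP; exists (i : nat) => //.
    by rewrite mem_iota add1n prednK // ltn_ord andbT lt0n.
  rewrite /evalr big_cons big_seq1 /= mul1r mulN1r (ME o o) ME => /eqP.
  by rewrite subr_eq0 => /eqP.
exists c; exists (dim X) => v.
have step m (w : 'rV[k]_(dim X)) :
    (forall j : 'I_(dim X), (m.+1 <= j)%N -> w 0 j = 0) ->
    forall j : 'I_(dim X), (m <= j)%N -> ((f - c *: \1%VF) w) 0 j = 0.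
  move=> w0 j mj; rewrite add_lfunE opp_lfunE scale_lfunE id_lfunE.
  rewrite [f]lmx_lin1 lmxE !mxE (bigD1 j) //= diag mulrC addrAC subrr add0r.
  apply: big1 => i ij; have [lij|lij] := leqP i j; last first.
    by rewrite w0 ?mul0r //; apply: leq_ltn_trans lij.
  by rewrite upper ?mulr0 // ltn_neqAle lij andbT.
have all_m m : (m <= dim X)%N -> forall j : 'I_(dim X), (dim X - m <= j)%N ->
    (iter m (f - c *: \1%VF) v) 0 j = 0.
  elim: m => [|m IH] md j; first by rewrite subn0 leqNgt ltn_ord.
  move=> dj; apply: (step (dim X - m.+1)%N) dj => l.
  by rewrite -subSn // subSS; apply: IH; apply: ltnW.
by apply/rowP => j; rewrite all_m ?subnn // mxE.
Qed.

Lemma scalar_check_nz : scalar_check X -> nonzero (realize hX).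
Proof.
case/andP=> d0 _; exists (const_mx 1 : 'rV[k]_(dim X)).
by apply/eqP => /rowP/(_ (Ordinal d0)); rewrite !mxE => /eqP; rewrite oner_eq0.
Qed.

End Scalar.

(** * The data of the fifty objects and of their almost split sequences *)

Definition mkobj u (rows : table) :=
  DObj (size rows) (nseq u true) (signed (size rows) (size rows) rows).

(** An exact sequence 0 -> K -> E -> X: the terms K and E are sums of listed objects, asG
    and asA are the matrices of E -> X and K -> E, and asR : E -> K, asS : X -> E are linear
    maps splitting the sequence, R A + G S = 1 and A R = 1 in the convention of row vectors.
    *)
Record almost_split_seq := AlmostSplit
  { asK : seq nat; asE : seq nat; asG : table; asA : table; asR : table; asS : table }.

(** The integers before the bar of a comment are the sizes of the Jordan blocks of T on V,
    with generators x, y, z; after the bar are generators of U as a T-stable subspace. The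
    bases used here refine a flag of subspaces stable under all endomorphisms and passing
    through U, which makes the endomorphisms triangular; the first argument of [mkobj] is
    the dimension of U. *)
Definition objs : seq dobj := [::
  (* 0: 1 | 0 *)
  mkobj 0 [:: [::]];
  (* 1: 1 | x *)
  mkobj 1 [:: [::]];
  (* 2: 2 | 0 *)
  mkobj 0 [:: [::]; [:: 1]];
  (* 3: 2 | Tx *)
  mkobj 1 [:: [::]; [:: 1]];
  (* 4: 2 | x *)
  mkobj 2 [:: [::]; [:: 1]];
  (* 5: 3 | 0 *)
  mkobj 0 [:: [::]; [:: 1]; [:: 2]];
  (* 6: 3 | T^2 x *)
  mkobj 1 [:: [::]; [:: 1]; [:: 2]];
  (* 7: 3 | Tx *)
  mkobj 2 [:: [::]; [:: 1]; [:: 2]];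
  (* 8: 3 | x *)
  mkobj 3 [:: [::]; [:: 1]; [:: 2]];
  (* 9: 4 | 0 *)
  mkobj 0 [:: [::]; [:: 1]; [:: 2]; [:: 3]];
  (* 10: 4 | T^3 x *)
  mkobj 1 [:: [::]; [:: 1]; [:: 2]; [:: 3]];
  (* 11: 4 | T^2 x *)
  mkobj 2 [:: [::]; [:: 1]; [:: 2]; [:: 3]];
  (* 12: 4 | Tx *)
  mkobj 3 [:: [::]; [:: 1]; [:: 2]; [:: 3]];
  (* 13: 4 | x *)
  mkobj 4 [:: [::]; [:: 1]; [:: 2]; [:: 3]];
  (* 14: 5 | 0 *)
  mkobj 0 [:: [::]; [:: 1]; [:: 2]; [:: 3]; [:: 4]];
  (* 15: 5 | T^4 x *)
  mkobj 1 [:: [::]; [:: 1]; [:: 2]; [:: 3]; [:: 4]];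
  (* 16: 5 | T^3 x *)
  mkobj 2 [:: [::]; [:: 1]; [:: 2]; [:: 3]; [:: 4]];
  (* 17: 5 | T^2 x *)
  mkobj 3 [:: [::]; [:: 1]; [:: 2]; [:: 3]; [:: 4]];
  (* 18: 5 | Tx *)
  mkobj 4 [:: [::]; [:: 1]; [:: 2]; [:: 3]; [:: 4]];
  (* 19: 5 | x *)
  mkobj 5 [:: [::]; [:: 1]; [:: 2]; [:: 3]; [:: 4]];
  (* 20: 5 3 | Tx + y *)
  mkobj 4 [:: [::]; [:: 1]; [:: 2]; [:: 3]; [:: 1]; [:: 5]; [:: 6]; [:: 7]];
  (* 21: 5 3 | T^2 x + Ty *)
  mkobj 3 [:: [::]; [:: 1]; [:: 2]; [:: 1]; [:: 4]; [:: 5]; [:: 3; -5]; [:: 6]];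
  (* 22: 5 3 | T^3 x + T^2 y *)
  mkobj 2 [:: [::]; [:: 1]; [:: 1]; [:: 3]; [:: 2; -3]; [:: 4]; [:: 5]; [:: 6]];
  (* 23: 5 2 | Tx + y *)
  mkobj 4 [:: [::]; [:: 1]; [:: 2]; [:: 3]; [:: 2]; [:: 5]; [:: 6]];
  (* 24: 5 2 | T^2 x + Ty *)
  mkobj 3 [:: [::]; [:: 1]; [:: 2]; [:: 2]; [:: 4]; [:: 3; -4]; [:: 5]];
  (* 25: 5 2 | T^2 x + y *)
  mkobj 3 [:: [::]; [:: 1]; [:: 2]; [:: 1]; [:: 4]; [:: 5]; [:: 6]];
  (* 26: 5 2 | T^3 x + Ty *)
  mkobj 2 [:: [::]; [:: 1]; [:: 1]; [:: 3]; [:: 4]; [:: 2; -3]; [:: 5]];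
  (* 27: 5 1 | Tx + y *)
  mkobj 4 [:: [::]; [:: 1]; [:: 2]; [:: 3]; [:: 3]; [:: 5]];
  (* 28: 5 1 | T^2 x + y *)
  mkobj 3 [:: [::]; [:: 1]; [:: 2]; [:: 2]; [:: 4]; [:: 5]];
  (* 29: 5 1 | T^3 x + y *)
  mkobj 2 [:: [::]; [:: 1]; [:: 1]; [:: 3]; [:: 4]; [:: 5]];
  (* 30: 4 2 | Tx + y *)
  mkobj 3 [:: [::]; [:: 1]; [:: 2]; [:: 1]; [:: 4]; [:: 5]];
  (* 31: 4 2 | T^2 x + Ty *)
  mkobj 2 [:: [::]; [:: 1]; [:: 1]; [:: 3]; [:: 2; -3]; [:: 4]];
  (* 32: 4 1 | Tx + y *)
  mkobj 3 [:: [::]; [:: 1]; [:: 2]; [:: 2]; [:: 4]];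
  (* 33: 4 1 | T^2 x + y *)
  mkobj 2 [:: [::]; [:: 1]; [:: 1]; [:: 3]; [:: 4]];
  (* 34: 3 1 | Tx + y *)
  mkobj 2 [:: [::]; [:: 1]; [:: 1]; [:: 3]];
  (* 35: 5 3 | Tx + y; T^2 x *)
  mkobj 6 [:: [::]; [:: 1]; [::]; [:: 2]; [:: 3]; [:: 4; 5]; [:: 4]; [:: 7]];
  (* 36: 5 3 | Tx + y; T^3 x *)
  mkobj 5 [:: [::]; [:: 1]; [::]; [:: 2; 3]; [:: 4]; [:: 2]; [:: 6]; [:: 7]];
  (* 37: 5 3 | T^2 x + Ty; T^3 x *)
  mkobj 4 [:: [::]; [:: 1]; [::]; [:: 2; 3]; [:: 2]; [:: 5]; [:: 4; -5]; [:: 6]];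
  (* 38: 5 2 | Tx + y; T^2 x *)
  mkobj 5 [:: [::]; [:: 1]; [:: 2]; [::]; [:: 3; 4]; [:: 3]; [:: 6]];
  (* 39: 5 2 | T^2 x + y; T^3 x *)
  mkobj 4 [:: [::]; [:: 1]; [::]; [:: 2; 3]; [:: 2]; [:: 5]; [:: 6]];
  (* 40: 4 2 | Tx + y; T^2 x *)
  mkobj 4 [:: [::]; [:: 1]; [::]; [:: 2; 3]; [:: 2]; [:: 5]];
  (* 41: 5 3 1 | T^2 x + Ty + z *)
  mkobj 3 [:: [::]; [:: 1]; [:: 2]; [:: 1]; [:: 4]; [:: 2; -4]; [:: 5]; [:: 6]; [:: 7]];
  (* 42: 5 4 2 | Tx + z; T^2 x + T^2 y *)
  mkobj 6 [:: [::]; [:: 1]; [::]; [:: 2; 3]; [:: 2]; [:: 5]; [:: 2]; [:: 7]; [:: 4; -7]; [:: 8];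
    [:: 9]];
  (* 43: 5 4 2 | Ty + z; T^3 x + T^2 y *)
  mkobj 5 [:: [::]; [::]; [:: 1; 2]; [:: 1]; [:: 3; -4]; [:: 1]; [:: 6]; [:: 3; -6]; [:: 7]; [::
    8]; [:: 9]];
  (* 44: 5 3 2 | Tx + y; T^2 x + Tz *)
  mkobj 6 [:: [::]; [:: 1]; [::]; [:: 2; 3]; [:: 2]; [:: 4]; [:: 2]; [:: 7]; [:: 5; -7]; [::
    8]];
  (* 45: 5 3 2 | T^2 x + z; T^3 x + T^2 y *)
  mkobj 4 [:: [::]; [:: 1]; [:: 1]; [:: 3]; [:: 1]; [:: 5]; [:: 2; -5]; [:: 6]; [:: 7]; [:: 8]];
  (* 46: 5 3 1 | Tx + y; T^2 x + z *)
  mkobj 6 [:: [::]; [:: 1]; [::]; [:: 2; 3]; [:: 2]; [:: 4]; [:: 2]; [:: 7]; [:: 8]];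
  (* 47: 5 3 1 | T^2 x + Ty; T^2 x + z *)
  mkobj 5 [:: [::]; [:: 1]; [::]; [:: 2; 3]; [:: 2]; [:: 2]; [:: 6]; [:: 4; -6]; [:: 7]];
  (* 48: 5 3 1 | T^2 x + Ty + z; T^3 x *)
  mkobj 4 [:: [::]; [:: 1]; [::]; [:: 2; 3]; [:: 2]; [:: 3]; [:: 5]; [:: 6]; [:: 7]];
  (* 49: 5 5 2 | Ty + z; T^3 x + Tz *)
  mkobj 6 [:: [::]; [::]; [:: 1]; [:: 2; -3]; [:: 2]; [:: -4; 5]; [:: 2]; [:: 7]; [:: -4; 7];
    [:: 8]; [:: 9]; [:: 10]]]%Z.

(** The j-th entry ends in the j-th object. For the two projective objects, number 14 and
    19, K is zero and E -> X is the inclusion of the largest proper subobject; the other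
    entries are the almost split sequences of the category. The splitting maps R preserve U.
    *)
Definition as_seqs : seq almost_split_seq := [::
  (* 0 *)
  AlmostSplit [:: 1]%N [:: 3]%N
    [:: [::]; [:: 1]]
    [:: [:: 1]]
    [:: [:: 1]; [::]]
    [:: [:: 2]];
  (* 1 *)
  AlmostSplit [:: 15]%N [:: 29]%N
    [:: [::]; [:: 1]; [::]; [::]; [::]; [::]]
    [:: [:: 1]; [:: 3]; [:: 4]; [:: 5]; [:: 6]]
    [:: [:: 1]; [::]; [:: 2]; [:: 3]; [:: 4]; [:: 5]]
    [:: [:: 2]];
  (* 2 *)
  AlmostSplit [:: 4]%N [:: 34]%N
    [:: [::]; [::]; [:: 1]; [:: 2]]
    [:: [:: 1]; [:: 2]]
    [:: [:: 1]; [:: 2]; [::]; [::]]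
    [:: [:: 3]; [:: 4]];
  (* 3 *)
  AlmostSplit [:: 29]%N [:: 1; 26]%N
    [:: [:: 1]; [::]; [:: 1]; [::]; [::]; [::]; [:: 2]; [::]]
    [:: [:: 2]; [:: -1; 3]; [:: 4]; [:: 5]; [:: 6]; [:: 8]]
    [:: [:: -2]; [:: 1]; [::]; [:: 3]; [:: 4]; [:: 5]; [::]; [:: 6]]
    [:: [:: 3]; [:: 7]];
  (* 4 *)
  AlmostSplit [:: 16]%N [:: 39]%N
    [:: [::]; [::]; [:: 1]; [:: 2]; [::]; [::]; [::]]
    [:: [:: 1]; [:: 2]; [:: 5]; [:: 6]; [:: 7]]
    [:: [:: 1]; [:: 2]; [::]; [::]; [:: 3]; [:: 4]; [:: 5]]
    [:: [:: 3]; [:: 4]];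
  (* 5 *)
  AlmostSplit [:: 8]%N [:: 30]%N
    [:: [::]; [::]; [::]; [:: 1]; [:: 2]; [:: 3]]
    [:: [:: 1]; [:: 2]; [:: 3]]
    [:: [:: 1]; [:: 2]; [:: 3]; [::]; [::]; [::]]
    [:: [:: 4]; [:: 5]; [:: 6]];
  (* 6 *)
  AlmostSplit [:: 25]%N [:: 45]%N
    [:: [::]; [:: 1]; [::]; [::]; [::]; [::]; [:: 2]; [::]; [:: 3]; [::]]
    [:: [:: 1]; [:: 3]; [:: 4]; [:: 5]; [:: 6]; [:: 8]; [:: 10]]
    [:: [:: 1]; [::]; [:: 2]; [:: 3]; [:: 4]; [:: 5]; [::]; [:: 6]; [::]; [:: 7]]
    [:: [:: 2]; [:: 7]; [:: 9]];
  (* 7 *)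
  AlmostSplit [:: 28]%N [:: 47]%N
    [:: [::]; [::]; [:: 1]; [:: 2]; [::]; [::]; [::]; [:: 3]; [::]]
    [:: [:: 1]; [:: 2]; [:: 5]; [:: 6]; [:: 7]; [:: 9]]
    [:: [:: 1]; [:: 2]; [::]; [::]; [:: 3]; [:: 4]; [:: 5]; [::]; [:: 6]]
    [:: [:: 3]; [:: 4]; [:: 8]];
  (* 8 *)
  AlmostSplit [:: 17]%N [:: 35]%N
    [:: [::]; [::]; [:: 1]; [::]; [:: 2]; [:: 3]; [::]; [::]]
    [:: [:: 1]; [:: 2]; [:: 4]; [:: 7]; [:: 8]]
    [:: [:: 1]; [:: 2]; [::]; [:: 3]; [::]; [::]; [:: 4]; [:: 5]]
    [:: [:: 3]; [:: 5]; [:: 6]];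
  (* 9 *)
  AlmostSplit [:: 13]%N [:: 20]%N
    [:: [::]; [::]; [::]; [::]; [:: 1]; [:: 2]; [:: 3]; [:: 4]]
    [:: [:: 1]; [:: 2]; [:: 3]; [:: 4]]
    [:: [:: 1]; [:: 2]; [:: 3]; [:: 4]; [::]; [::]; [::]; [::]]
    [:: [:: 5]; [:: 6]; [:: 7]; [:: 8]];
  (* 10 *)
  AlmostSplit [:: 20]%N [:: 9; 36]%N
    [:: [:: 1]; [:: 2]; [:: 3]; [:: 4]; [::]; [:: 1]; [:: -1]; [::]; [::]; [:: 2]; [:: 3]; [::
      4]]
    [:: [:: 5]; [:: 6; 7]; [:: 8]; [:: 9]; [:: -1; 6]; [:: -2; 10]; [:: -3; 11]; [:: -4; 12]]
    [:: [:: -5]; [:: -6]; [:: -7]; [:: -8]; [:: 1]; [::]; [:: 2]; [:: 3]; [:: 4]; [::]; [::];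
      [::]]
    [:: [:: 6]; [:: 10]; [:: 11]; [:: 12]];
  (* 11 *)
  AlmostSplit [:: 23]%N [:: 42]%N
    [:: [::]; [::]; [:: 1]; [:: 2]; [::]; [::]; [::]; [::]; [:: 3]; [::]; [:: 4]]
    [:: [:: 1]; [:: 2]; [:: 5]; [:: 6]; [:: 7]; [:: 8]; [:: 10]]
    [:: [:: 1]; [:: 2]; [::]; [::]; [:: 3]; [:: 4]; [:: 5]; [:: 6]; [::]; [:: 7]; [::]]
    [:: [:: 3]; [:: 4]; [:: 9]; [:: 11]];
  (* 12 *)
  AlmostSplit [:: 27]%N [:: 18; 32]%N
    [:: [::]; [:: 1]; [:: 2]; [:: 3]; [:: 4]; [:: 1]; [:: 2]; [:: 3]; [:: 3]; [:: 4]]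
    [:: [:: -1]; [:: -2; 6]; [:: -3; 7]; [:: -4; 8]; [:: -4; 9]; [:: -5; 10]]
    [:: [:: -1]; [:: -2]; [:: -3]; [::]; [:: -6]; [::]; [::]; [:: 4]; [:: 5]; [::]]
    [:: [:: 6]; [:: 7]; [:: 4]; [:: 10]];
  (* 13 *)
  AlmostSplit [:: 18]%N [:: 12; 19]%N
    [:: [:: 1]; [:: 2]; [:: 3]; [:: 4]; [::]; [:: 1]; [:: 2]; [:: 3]; [:: 4]]
    [:: [:: 5]; [:: -1; 6]; [:: -2; 7]; [:: -3; 8]; [:: -4; 9]]
    [:: [:: -2]; [:: -3]; [:: -4]; [:: -5]; [:: 1]; [::]; [::]; [::]; [::]]
    [:: [:: 6]; [:: 7]; [:: 8]; [:: 9]];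
  (* 14 *)
  AlmostSplit [::]%N [:: 9]%N
    [:: [:: 1]; [:: 2]; [:: 3]; [:: 4]]
    [::]
    [:: [::]; [::]; [::]; [::]]
    [:: [:: 1]; [:: 2]; [:: 3]; [:: 4]; [::]];
  (* 15 *)
  AlmostSplit [:: 9]%N [:: 10; 14]%N
    [:: [:: 1]; [:: 2]; [:: 3]; [:: 4]; [:: 1]; [:: 2]; [:: 3]; [:: 4]; [:: 5]]
    [:: [:: -1; 5]; [:: -2; 6]; [:: -3; 7]; [:: -4; 8]]
    [:: [::]; [:: -2]; [:: -3]; [:: -4]; [:: 1]; [::]; [::]; [::]; [::]]
    [:: [:: 1]; [:: 6]; [:: 7]; [:: 8]; [:: 9]];
  (* 16 *)
  AlmostSplit [:: 5]%N [:: 22]%N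
    [:: [:: 1]; [:: 2]; [:: 2]; [:: 3]; [::]; [:: 4]; [::]; [:: 5]]
    [:: [:: 2; -3]; [:: 5]; [:: 7]]
    [:: [::]; [::]; [:: -1]; [::]; [:: 2]; [::]; [:: 3]; [::]]
    [:: [:: 1]; [:: 2]; [:: 4]; [:: 6]; [:: 8]];
  (* 17 *)
  AlmostSplit [:: 2]%N [:: 24]%N
    [:: [:: 1]; [:: 2]; [:: 3]; [:: 3]; [:: 4]; [::]; [:: 5]]
    [:: [:: 3; -4]; [:: 6]]
    [:: [::]; [::]; [::]; [:: -1]; [::]; [:: 2]; [::]]
    [:: [:: 1]; [:: 2]; [:: 3]; [:: 5]; [:: 7]];
  (* 18 *)
  AlmostSplit [:: 0]%N [:: 27]%N
    [:: [:: 1]; [:: 2]; [:: 3]; [:: 4]; [:: 4]; [:: 5]]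
    [:: [:: -4; 5]]
    [:: [::]; [::]; [::]; [::]; [:: 1]; [::]]
    [:: [:: 1]; [:: 2]; [:: 3]; [:: 4]; [:: 6]];
  (* 19 *)
  AlmostSplit [::]%N [:: 18]%N
    [:: [:: 1]; [:: 2]; [:: 3]; [:: 4]; [:: 5]]
    [::]
    [:: [::]; [::]; [::]; [::]; [::]]
    [:: [:: 1]; [:: 2]; [:: 3]; [:: 4]; [:: 5]];
  (* 20 *)
  AlmostSplit [:: 12]%N [:: 13; 21]%N
    [:: [:: 1]; [:: 2]; [:: 3]; [:: 4]; [:: 1]; [:: 2]; [:: 3]; [:: 5]; [:: 6]; [:: 7]; [:: 4;
      -7]; [:: 8]]
    [:: [:: -1; 5]; [:: -2; 6]; [:: -3; 7]; [:: -4; 10; 11]]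
    [:: [:: -1]; [:: -2]; [:: -3]; [::]; [::]; [::]; [::]; [::]; [::]; [::]; [:: 4]; [::]]
    [:: [:: 5]; [:: 6]; [:: 7]; [:: 4]; [:: 8]; [:: 9]; [:: 10]; [:: 12]];
  (* 21 *)
  AlmostSplit [:: 32]%N [:: 12; 41]%N
    [:: [:: 1]; [:: 2]; [:: 3]; [:: 6; 7]; [:: 1]; [:: 2]; [:: 3]; [:: 4]; [:: 5]; [:: 3; -5];
      [:: 6]; [:: 7]; [:: 8]]
    [:: [:: -1; 5]; [:: -2; 6]; [:: -3; 7]; [:: -3; 9; 10]; [:: -4; 11; 12]]
    [:: [:: -1]; [:: -2]; [::]; [:: -5]; [::]; [::]; [:: 3]; [::]; [::]; [:: 4]; [::]; [::];
      [::]]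
    [:: [:: 5]; [:: 6]; [:: 3]; [:: 8]; [:: 9]; [:: 11]; [:: 12]; [:: 13]];
  (* 22 *)
  AlmostSplit [:: 30]%N [:: 5; 43]%N
    [:: [:: 2; -3]; [:: 5]; [:: 7]; [:: 1]; [::]; [:: 2]; [:: 2]; [::]; [:: 3]; [:: 4]; [:: 5];
      [:: 6]; [:: 7]; [:: 8]]
    [:: [:: 5]; [:: 6; -7]; [:: 8]; [:: -1; 6; -9]; [:: -2; 11]; [:: -3; 13]]
    [:: [:: -4]; [:: -5]; [:: -6]; [::]; [:: 1]; [::]; [:: -2]; [:: 3]; [::]; [::]; [::]; [::];
      [::]; [::]]
    [:: [:: 4]; [:: 6]; [:: 9]; [:: 10]; [:: 11]; [:: 12]; [:: 13]; [:: 14]];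
  (* 23 *)
  AlmostSplit [:: 7]%N [:: 44]%N
    [:: [:: 1]; [:: 2]; [::]; [:: 3]; [:: 3]; [:: 4]; [:: 5]; [:: 6]; [:: 4; -6]; [:: 7]]
    [:: [:: -3]; [:: -4; 5]; [:: -6; 8; 9]]
    [:: [::]; [::]; [:: -1]; [:: -2]; [::]; [::]; [::]; [::]; [:: 3]; [::]]
    [:: [:: 1]; [:: 2]; [:: 5]; [:: 6]; [:: 7]; [:: 8]; [:: 10]];
  (* 24 *)
  AlmostSplit [:: 34]%N [:: 2; 47]%N
    [:: [:: 3; -4]; [:: 6]; [:: 1]; [:: 2]; [::]; [:: 3]; [:: 3]; [:: 4]; [:: 5]; [:: 6]; [::
      7]]
    [:: [:: 5]; [:: 6; -7]; [:: -1; 6; -8]; [:: -2; 10]]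
    [:: [:: -3]; [:: -4]; [::]; [::]; [:: 1]; [::]; [:: -2]; [::]; [::]; [::]; [::]]
    [:: [:: 3]; [:: 4]; [:: 6]; [:: 8]; [:: 9]; [:: 10]; [:: 11]];
  (* 25 *)
  AlmostSplit [:: 11]%N [:: 43]%N
    [:: [:: 1]; [:: -1]; [::]; [:: 2]; [:: -3]; [:: 4]; [:: 5]; [:: -5]; [:: 6]; [:: -6]; [::
      7]]
    [:: [:: 1; 2]; [:: 3]; [:: 7; 8]; [:: 9; 10]]
    [:: [:: 1]; [::]; [:: 2]; [::]; [::]; [::]; [:: 3]; [::]; [:: 4]; [::]; [::]]
    [:: [:: -2]; [:: 4]; [:: -5]; [:: 6]; [:: -8]; [:: -10]; [:: 11]];
  (* 26 *)
  AlmostSplit [:: 33]%N [:: 29; 31]%N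
    [:: [:: 1]; [:: 2]; [:: 3]; [:: 4]; [:: 5]; [:: 7]; [:: 1]; [:: 2]; [:: 3]; [:: 4]; [:: 6];
      [:: 5]]
    [:: [:: -1; 7]; [:: -2; 8]; [:: -3; 9]; [:: -4; 10]; [:: -5; 12]]
    [:: [:: -1]; [:: -2]; [:: -3]; [:: -4]; [:: -5]; [::]; [::]; [::]; [::]; [::]; [::]; [::]]
    [:: [:: 7]; [:: 8]; [:: 9]; [:: 10]; [:: 12]; [:: 11]; [:: 6]];
  (* 27 *)
  AlmostSplit [:: 3]%N [:: 0; 38]%N
    [:: [:: -4; 5]; [:: 1]; [:: 2]; [:: 3]; [::]; [:: 4]; [:: 5]; [:: 6]]
    [:: [:: -5]; [:: -1; -6; 7]]
    [:: [:: -2]; [::]; [::]; [::]; [:: -1]; [::]; [::]; [::]]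
    [:: [:: 2]; [:: 3]; [:: 4]; [:: 6]; [:: 7]; [:: 8]];
  (* 28 *)
  AlmostSplit [:: 6]%N [:: 48]%N
    [:: [:: 1]; [:: 2]; [::]; [:: 3]; [:: 4]; [::]; [:: 5]; [::]; [:: 6]]
    [:: [:: 3]; [:: 6]; [:: 8]]
    [:: [::]; [::]; [:: 1]; [::]; [::]; [:: 2]; [::]; [:: 3]; [::]]
    [:: [:: 1]; [:: 2]; [:: 4]; [:: 5]; [:: 7]; [:: 9]];
  (* 29 *)
  AlmostSplit [:: 10]%N [:: 15; 33]%N
    [:: [:: 1]; [:: 3]; [:: 4]; [:: 5]; [:: 6]; [:: 1]; [:: 2]; [:: 3]; [:: 4]; [:: 5]]
    [:: [:: -1; 6]; [:: -2; 8]; [:: -3; 9]; [:: -4; 10]]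
    [:: [:: -1]; [:: -2]; [:: -3]; [:: -4]; [::]; [::]; [::]; [::]; [::]; [::]]
    [:: [:: 6]; [:: 7]; [:: 8]; [:: 9]; [:: 10]; [:: 5]];
  (* 30 *)
  AlmostSplit [:: 35]%N [:: 8; 42]%N
    [:: [:: 1]; [:: 2]; [:: 3]; [::]; [:: -1]; [:: 1]; [::]; [:: -2]; [:: -3]; [:: -4]; [:: -5];
      [:: 5]; [:: -6]; [:: 6]]
    [:: [:: 4]; [:: 5; 6]; [:: 1; -6]; [:: 7]; [:: 2; -7; 8]; [:: 3; 9]; [:: 11; 12]; [:: 13;
      14]]
    [:: [:: 3]; [:: 4; 5]; [:: 6]; [:: 1]; [:: 2]; [::]; [:: 4]; [::]; [::]; [::]; [:: 7]; [::];
      [:: 8]; [::]]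
    [:: [:: 6]; [:: -8]; [:: -9]; [:: -10]; [:: 12]; [:: 14]];
  (* 31 *)
  AlmostSplit [:: 46]%N [:: 33; 44]%N
    [:: [:: 1]; [:: 2]; [:: 3]; [:: 4]; [:: 6]; [::]; [:: 1]; [:: -1]; [::]; [:: 2]; [::]; [::
      3]; [:: 4]; [:: 5]; [:: 6]]
    [:: [:: 6]; [:: -1; 7]; [:: 1; 8]; [:: 9]; [:: -2; 10]; [:: 11]; [:: -3; 12]; [:: -4; 13];
      [:: -5; 15]]
    [:: [::]; [:: -5]; [:: -7]; [:: -8]; [:: -9]; [:: 1]; [:: 2]; [:: 3]; [:: 4]; [::]; [:: 6];
      [::]; [::]; [::]; [::]]
    [:: [:: 1]; [:: 10]; [:: 12]; [:: 13]; [:: 14]; [:: 15]];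
  (* 32 *)
  AlmostSplit [:: 38]%N [:: 27; 40]%N
    [:: [::]; [:: 1]; [:: 2]; [:: 3]; [:: 4]; [:: 5]; [:: 1]; [:: 2]; [::]; [:: 3]; [:: 4]; [::
      5]]
    [:: [:: -1]; [:: -2; 7]; [:: -3; 8]; [:: 9]; [:: -4; 10]; [:: -5; 11]; [:: -6; 12]]
    [:: [:: -1]; [:: -2]; [:: -3]; [:: -5]; [:: -6]; [:: -7]; [::]; [::]; [:: 4]; [::]; [::];
      [::]]
    [:: [:: 7]; [:: 8]; [:: 10]; [:: 11]; [:: 12]];
  (* 33 *)
  AlmostSplit [:: 36]%N [:: 10; 46]%N
    [:: [:: 1]; [:: 3]; [:: 4]; [:: 5]; [::]; [:: 1]; [:: -1]; [::]; [:: 2]; [::]; [:: 3]; [::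
      4]; [:: 5]]
    [:: [:: 5]; [:: -1; 6]; [:: 1; 7]; [:: 8]; [:: 10]; [:: -2; 11]; [:: -3; 12]; [:: -4; 13]]
    [:: [::]; [:: -6]; [:: -7]; [:: -8]; [:: 1]; [:: 2]; [:: 3]; [:: 4]; [::]; [:: 5]; [::];
      [::]; [::]]
    [:: [:: 1]; [:: 9]; [:: 11]; [:: 12]; [:: 13]];
  (* 34 *)
  AlmostSplit [:: 39]%N [:: 4; 48]%N
    [:: [:: 1]; [:: 2]; [::]; [::]; [:: 1]; [:: 2]; [::]; [:: 3]; [::]; [:: 4]; [::]]
    [:: [:: 3]; [:: 4]; [:: -1; 5]; [:: -2; 6]; [:: 7]; [:: 9]; [:: 11]]
    [:: [:: -3]; [:: -4]; [:: 1]; [:: 2]; [::]; [::]; [:: 5]; [::]; [:: 6]; [::]; [:: 7]]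
    [:: [:: 5]; [:: 6]; [:: 8]; [:: 10]];
  (* 35 *)
  AlmostSplit [:: 24]%N [:: 17; 44]%N
    [:: [:: 1]; [:: 2]; [:: 4]; [:: 7]; [:: 8]; [:: 1]; [:: 2]; [:: 3]; [:: 4; 5]; [:: 4]; [::
      6]; [:: 4]; [:: 7]; [::]; [:: 8]]
    [:: [:: -1; 6]; [:: -2; 7]; [:: -3; 10]; [:: -3; 12]; [:: -4; 13]; [:: 14]; [:: -5; 15]]
    [:: [:: -1]; [:: -2]; [::]; [:: -5]; [:: -7]; [::]; [::]; [::]; [::]; [:: 3]; [::]; [:: 4];
      [::]; [:: 6]; [::]]
    [:: [:: 6]; [:: 7]; [:: 8]; [:: 3]; [:: -3; 9]; [:: 11]; [:: 13]; [:: 15]];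
  (* 36 *)
  AlmostSplit [:: 21]%N [:: 20; 37]%N
    [:: [:: 1]; [:: 2; 3]; [:: 4]; [:: 5]; [:: 2]; [:: 6]; [:: 7]; [:: 8]; [:: 1]; [:: 2]; [::
      3]; [:: 4]; [:: 6]; [:: 7]; [:: 5; -7]; [:: 8]]
    [:: [:: -1; 9]; [:: -2; 10; 11]; [:: -3; 12]; [:: -5; 10]; [:: -6; 13]; [:: -7; 14]; [:: -4;
      7; 15]; [:: -8; 16]]
    [:: [:: -1]; [:: -2]; [:: -3]; [::]; [:: -4]; [:: -5]; [::]; [:: -8]; [::]; [::]; [::];
      [::]; [::]; [:: 6]; [:: 7]; [::]]
    [:: [:: 9]; [:: 10]; [:: 11]; [:: 12]; [:: 4]; [:: 13]; [:: 7]; [:: 16]];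
  (* 37 *)
  AlmostSplit [:: 41]%N [:: 21; 48]%N
    [:: [:: 1]; [:: 2; 3]; [:: 4]; [:: 2]; [:: 5]; [:: 6]; [:: 7]; [:: 8]; [:: 1]; [:: 2]; [::
      3]; [:: 4]; [:: 5]; [:: 4; -5]; [:: 6]; [:: 7]; [:: 8]]
    [:: [:: -1; 9]; [:: -2; 10; 11]; [:: -3; 12]; [:: -4; 10]; [:: -5; 13]; [:: -3; 5; 14]; [::
      -6; 15]; [:: -7; 16]; [:: -8; 17]]
    [:: [:: -1]; [:: -2]; [::]; [:: -4]; [:: -5]; [:: -7]; [:: -8]; [:: -9]; [::]; [::]; [::];
      [:: 3]; [::]; [:: 5; 6]; [::]; [::]; [::]]
    [:: [:: 9]; [:: 10]; [:: 11]; [:: 3]; [:: 13]; [:: 15]; [:: 16]; [:: 17]];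
  (* 38 *)
  AlmostSplit [:: 26]%N [:: 3; 49]%N
    [:: [:: -4]; [:: -5; 6]; [:: 1]; [::]; [:: 2]; [:: -3]; [:: 4]; [:: 5]; [::]; [::]; [:: 6];
      [::]; [:: 7]; [::]]
    [:: [:: 4]; [:: 1; 7]; [:: 9]; [:: 10]; [:: 12]; [:: 2; 8; -11]; [:: 14]]
    [:: [:: 2]; [:: 6]; [::]; [:: 1]; [::]; [::]; [::]; [::]; [:: 3]; [:: 4]; [::]; [:: 5];
      [::]; [:: 7]]
    [:: [:: 3]; [:: 5]; [:: -6]; [:: 7]; [:: 8]; [:: 11]; [:: 13]];
  (* 39 *)
  AlmostSplit [:: 22]%N [:: 16; 45]%N
    [:: [:: 1]; [:: 2]; [:: 5]; [:: 6]; [:: 7]; [:: 1]; [:: 2]; [:: 2; 3]; [:: 4]; [:: 2]; [::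
      5]; [::]; [:: 6]; [::]; [:: 7]]
    [:: [:: -1; 6]; [:: -2; 7]; [:: -2; 10]; [:: -3; 11]; [:: 12]; [:: -4; 13]; [:: 14]; [:: -5;
      15]]
    [:: [:: -1]; [::]; [:: -4]; [:: -6]; [:: -8]; [::]; [:: 2]; [::]; [::]; [:: 3]; [::]; [::
      5]; [::]; [:: 7]; [::]]
    [:: [:: 6]; [:: 2]; [:: -2; 8]; [:: 9]; [:: 11]; [:: 13]; [:: 15]];
  (* 40 *)
  AlmostSplit [:: 49]%N [:: 38; 43]%N
    [:: [::]; [:: 1]; [:: 2]; [:: 3]; [:: 4]; [:: 5]; [:: 6]; [::]; [:: 1]; [:: 2]; [:: -3]; [::
      4]; [::]; [::]; [:: 5]; [::]; [:: 6]; [::]]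
    [:: [:: 1]; [:: 8]; [:: 2; -9]; [:: -3; 10]; [:: 4; 11]; [:: 5; -12]; [:: 13]; [:: 14]; [::
      6; -15]; [:: 16]; [:: 7; -17]; [:: 18]]
    [:: [:: 1]; [:: 3]; [:: -4]; [:: 5]; [:: 6]; [:: 9]; [:: 11]; [:: 2]; [::]; [::]; [::];
      [::]; [:: 7]; [:: 8]; [::]; [:: 10]; [::]; [:: 12]]
    [:: [:: 9]; [:: 10]; [:: -11]; [:: 12]; [:: 15]; [:: 17]];
  (* 41 *)
  AlmostSplit [:: 40]%N [:: 32; 45]%N
    [:: [:: 1]; [:: 2]; [:: 3]; [:: 5; 6]; [:: 7; 8]; [:: 1]; [:: 2]; [:: 2]; [:: 3]; [:: 4];
      [:: 5]; [:: 6]; [:: 7]; [:: 8]; [:: 9]]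
    [:: [:: -1; 6]; [:: -2; 7]; [:: -7; 8]; [:: -3; 9]; [:: -4; 11; 12]; [:: -5; 13; 14]]
    [:: [:: -1]; [:: -2]; [:: -4]; [:: -5]; [:: -6]; [::]; [::]; [:: 3]; [::]; [::]; [::]; [::];
      [::]; [::]; [::]]
    [:: [:: 6]; [:: 7]; [:: 9]; [:: 10]; [:: 11]; [:: 12]; [:: 13]; [:: 14]; [:: 15]];
  (* 42 *)
  AlmostSplit [:: 44]%N [:: 23; 31; 35]%N
    [:: [:: 1]; [:: 2]; [:: 5]; [:: 6]; [:: 7]; [:: 8]; [:: 10]; [:: 3]; [:: 4; -5]; [:: 4; -7];
      [:: 9]; [:: -6; 8]; [:: 11]; [:: 1]; [:: 2; 3]; [:: -3]; [:: 4]; [:: -4; 5]; [:: 6]; [::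
      8; 9]; [:: 10; 11]]
    [:: [:: -1; 14]; [:: -2; -8; 15]; [:: 8; 16]; [:: -3; 17; 18]; [:: -3; -9; 17]; [:: -4; 19];
      [:: -5; -10; 17]; [:: -6; -11; 20]; [:: -4; 6; -12]; [:: -7; -13; 21]]
    [:: [:: -1]; [:: -2]; [:: -4]; [::]; [:: -7]; [::]; [:: -10]; [::]; [:: 4; -5]; [::]; [::];
      [:: -9]; [::]; [::]; [::]; [:: 3]; [::]; [::]; [:: 6]; [:: 8]; [::]]
    [:: [:: 14]; [:: -8; 15]; [:: 8]; [:: 17]; [:: 17; 18]; [:: 4]; [:: -10; 17]; [:: 6]; [::
      11]; [:: -13; 21]; [:: 13]];
  (* 43 *)
  AlmostSplit [:: 42]%N [:: 11; 30; 49]%N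
    [:: [:: 1; 2]; [:: 3]; [:: 7; 8]; [:: 9; 10]; [:: 2]; [:: 3; -4]; [:: 5]; [:: 3; -6]; [::
      8]; [:: 10]; [::]; [:: 1]; [:: -2]; [:: 3]; [:: 4]; [:: -5]; [:: 6]; [:: 7]; [:: -8]; [::
      9]; [:: -10]; [:: 11]]
    [:: [:: -11]; [:: -5; -13]; [:: -1; 5; 12]; [:: -2; 14]; [:: -6; 14; -15]; [:: -7; -16]; [::
      -8; 14; -17]; [:: -9; -19]; [:: -3; 9; 18]; [:: -10; -21]; [:: -4; 10; 20]]
    [:: [:: -3]; [:: -4]; [:: -9]; [:: -11]; [::]; [:: -5]; [:: -6]; [:: -7]; [::]; [::]; [::
      -1]; [::]; [:: -2]; [::]; [::]; [::]; [::]; [::]; [:: -8]; [::]; [:: -10]; [::]]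
    [:: [:: 12]; [:: 5]; [:: 14]; [:: 15]; [:: -16]; [:: 17]; [:: 18]; [:: 9]; [:: 20]; [:: 10];
      [:: 22]];
  (* 44 *)
  AlmostSplit [:: 47]%N [:: 7; 24; 46]%N
    [:: [:: -3]; [:: -4; 5]; [:: -6; 8; 9]; [:: 1]; [:: 2]; [:: 5]; [:: 7]; [:: 8]; [:: 9]; [::
      10]; [:: 1]; [:: 2]; [:: 3]; [:: 4]; [:: 5]; [:: 6]; [:: 7]; [:: 8]; [:: 10]]
    [:: [:: -4; 11]; [:: -5; 12]; [:: 1; 13]; [:: 2; -6; 14]; [:: -6; 15]; [:: -7; 17]; [:: -8;
      18]; [:: 3; -9; 16; -18]; [:: -10; 19]]
    [:: [:: 3]; [:: 4]; [:: 8]; [:: -1]; [:: -2]; [::]; [:: -6]; [:: -7]; [::]; [:: -9]; [::];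
      [::]; [::]; [::]; [:: 5]; [::]; [::]; [::]; [::]]
    [:: [:: 11]; [:: 12]; [:: 13]; [:: 14]; [:: 6]; [:: 16]; [:: 17]; [:: 18]; [:: 9]; [:: 19]];
  (* 45 *)
  AlmostSplit [:: 43]%N [:: 22; 25; 40]%N
    [:: [:: 1]; [:: 2]; [:: 5]; [:: 6]; [:: 7]; [:: 8]; [:: 9]; [:: 10]; [:: 1]; [:: 3]; [:: 4];
      [:: 5]; [:: 6]; [:: 8]; [:: 10]; [:: 1]; [:: 2]; [:: -2; 3]; [:: 4]; [:: 6; 7]; [:: 8; 9]]
    [:: [:: -1; 9]; [:: -9; 16]; [:: -2; 17]; [:: -2; 10; -18]; [:: -11; 19]; [:: -3; 12]; [::
      -4; 13]; [:: -5; -13; 20]; [:: -6; 14]; [:: -7; -14; 21]; [:: -8; 15]]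
    [:: [:: -1]; [:: -3]; [:: -6]; [:: -7]; [:: -8]; [:: -9]; [::]; [:: -11]; [::]; [::]; [::
      -5]; [::]; [::]; [::]; [::]; [:: 2]; [::]; [:: 3; -4]; [::]; [::]; [:: 10]]
    [:: [:: 9]; [:: 17]; [:: 10]; [:: 19]; [:: 12]; [:: 13]; [:: -13; 20]; [:: 14]; [:: 7]; [::
      15]];
  (* 46 *)
  AlmostSplit [:: 37]%N [:: 36; 47]%N
    [:: [:: 1]; [:: 2]; [:: 3]; [:: 4]; [:: 6]; [:: 7]; [:: 8]; [:: 9]; [:: 1]; [:: 2]; [:: 3];
      [:: 4]; [:: 5]; [:: 7]; [:: 8]; [:: 6; -8]; [:: 9]]
    [:: [:: -1; 9]; [:: -2; 10]; [:: -3; 11]; [:: -4; 12]; [:: -6; 14]; [:: -7; 15]; [:: -5; 7;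
      16]; [:: -8; 17]]
    [:: [:: -1]; [:: -2]; [:: -3]; [:: -4]; [::]; [:: -5]; [::]; [:: -8]; [::]; [::]; [::];
      [::]; [::]; [::]; [:: 6]; [:: 7]; [::]]
    [:: [:: 9]; [:: 10]; [:: 11]; [:: 12]; [:: 13]; [:: 5]; [:: 14]; [:: 7]; [:: 17]];
  (* 47 *)
  AlmostSplit [:: 48]%N [:: 28; 34; 37]%N
    [:: [:: 1]; [:: 2]; [:: 5]; [:: 6]; [:: 7]; [:: 9]; [:: 3]; [:: 4; -5]; [:: 4; -6]; [:: 8];
      [:: 1]; [:: 2]; [:: 3]; [:: 4]; [:: 6]; [:: 7]; [:: 8]; [:: 9]]
    [:: [:: -1; 11]; [:: -2; 12]; [:: -7; 13]; [:: -3; -8; 14]; [:: -4; 15]; [:: -9; 14; -15];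
      [:: -5; 16]; [:: -10; 17]; [:: -6; 18]]
    [:: [:: -1]; [:: -2]; [::]; [:: -5]; [:: -7]; [:: -9]; [:: -3]; [:: -4]; [:: -6]; [:: -8];
      [::]; [::]; [::]; [::]; [::]; [::]; [::]; [::]]
    [:: [:: 11]; [:: 12]; [:: 13]; [:: 14]; [:: 3]; [:: 15]; [:: 16]; [:: 17]; [:: 18]];
  (* 48 *)
  AlmostSplit [:: 45]%N [:: 6; 39; 41]%N
    [:: [:: 3]; [:: 6]; [:: 8]; [:: 1]; [:: 2]; [:: 3]; [:: 4]; [:: 5]; [:: 7]; [:: 9]; [:: 1];
      [:: 2; 3]; [:: 4]; [:: 2]; [:: 5]; [:: 6]; [:: 7]; [:: 8]; [:: 9]]
    [:: [:: -4; 11]; [:: -1; -5; 12]; [:: -5; -6; 12]; [:: -7; 13]; [:: -5; 14]; [:: -8; 15];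
      [:: -2; 16]; [:: -9; 17]; [:: -3; 18]; [:: -10; 19]]
    [:: [:: -2]; [:: -7]; [:: -9]; [:: -1]; [::]; [:: -3]; [:: -4]; [:: -6]; [:: -8]; [:: -10];
      [::]; [::]; [::]; [:: 5]; [::]; [::]; [::]; [::]; [::]]
    [:: [:: 11]; [:: 5]; [:: -5; 12]; [:: 13]; [:: 15]; [:: 16]; [:: 17]; [:: 18]; [:: 19]];
  (* 49 *)
  AlmostSplit [:: 31]%N [:: 26; 42]%N
    [:: [:: 2]; [:: 5]; [:: 7]; [:: 8]; [:: 10]; [:: 6; -9]; [:: 12]; [:: -1]; [:: -3]; [:: 2];
      [:: 4]; [:: 4; -5]; [:: -6]; [:: 4; -7]; [:: -9]; [:: 8]; [:: -11]; [:: 10]]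
    [:: [:: -1; 10]; [:: -2; 11; -12]; [:: -3; 11; -14]; [:: -4; 16]; [:: -6; -13; 15]; [:: -5;
      18]]
    [:: [:: -1]; [::]; [::]; [:: -4]; [:: -6]; [:: -5]; [::]; [::]; [::]; [::]; [::]; [:: -2];
      [::]; [:: -3]; [::]; [::]; [::]; [::]]
    [:: [:: -8]; [:: 10]; [:: -9]; [:: 11]; [:: 2]; [:: -13]; [:: 3]; [:: 16]; [:: -15]; [::
      18]; [:: -17]; [:: 7]]]%Z.

Definition obj i := nth zobj objs i.
Definition csum_list := foldr (fun i => csum (obj i)) zobj.
Definition nilp_check n X := eqf (dim X) (dim X) (ent (powt n (dim X) (tm X))) (fun _ _ => 0%Z).

Definition as_seq0 := AlmostSplit [::] [::] [::] [::] [::] [::].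
Definition as_seq j := nth as_seq0 as_seqs j.
Definition sumE j := csum_list (asE (as_seq j)).
Definition sumK j := csum_list (asK (as_seq j)).
Definition matG j := signed (dim (sumE j)) (dim (obj j)) (asG (as_seq j)).
Definition matA j := signed (dim (sumK j)) (dim (sumE j)) (asA (as_seq j)).
Definition matR j := signed (dim (sumE j)) (dim (sumK j)) (asR (as_seq j)).
Definition matS j := signed (dim (obj j)) (dim (sumE j)) (asS (as_seq j)).

Definition morb X Y M :=
  maskb X Y M && eqf (dim X) (dim Y) (mulf (dim X) (tm X) M) (mulf (dim Y) M (tm Y)).

Definition exact_check X E K G A R S :=
  [&& morb E X G, morb K E A, maskb E K R,
      eqf (dim K) (dim X) (mulf (dim E) A G) (fun _ _ => 0%Z),
      eqf (dim K) (dim K) (mulf (dim E) A R) idf &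
      eqf (dim E) (dim E)
        (fun i j => intZmod.addz (mulf (dim K) R A i j) (mulf (dim X) G S i j)) idf].

Definition almost_split_check j :=
  [&& all (gtn 50) (asE (as_seq j)), all (gtn 50) (asK (as_seq j)) &
      exact_check (obj j) (sumE j) (sumK j) (matG j) (matA j) (matR j) (matS j)].

(** The table of dimensions is computed once; an elimination that met a pivot other than 1
    and -1 would show up as None. *)
Definition dims_check :=
  let H := [seq [seq hdim x y | y <- objs] | x <- objs] in
  let h i j := odflt 0%N (nth None (nth [::] H i) j) in
  all (all isSome) H &&
  all (fun j => all (fun i =>
     (sumn [seq h i l | l <- asE (as_seq j)] + (i == j) ==
      h i j + sumn [seq h i l | l <- asK (as_seq j)])%N) (iota 0 50)) (iota 0 50).

(** A witness that T^n does not vanish over any field. *)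
Definition unit_power n X :=
  let M := powt n (dim X) (tm X) in
  has (fun i => has (fun j => (ent M i j == 1%Z) || (ent M i j == (-1)%Z)) (iota 0 (dim X)))
    (iota 0 (dim X)).
Definition nilp_unit_check :=
  all (fun n => all (fun X => nilp_check n X || unit_power n X) objs) (iota 1 5).
(** A single Jordan block of size 5 with U everything or zero: the injective objects. *)
Definition chain5 X b := [&& dim X == 5, mask X == (if b then nseq 5 true else [::]) &
  eqf 5 5 (ent (tm X)) (fun i j => if i == j.+1 then 1%Z else 0%Z)].

Definition objs_check := all (fun X => nilp_check 5 X && maskb X X (tm X) && scalar_check X) objs.
Lemma objs_checkT : objs_check. Proof. by vm_cast_no_check (erefl true). Qed.
Lemma dims_checkT : dims_check. Proof. by vm_cast_no_check (erefl true). Qed.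
Lemma almost_split_checkT : all almost_split_check (iota 0 50).
Proof. by vm_cast_no_check (erefl true). Qed.
Lemma nilp_unit_checkT : nilp_unit_check. Proof. by vm_cast_no_check (erefl true). Qed.
Lemma chainT : chain5 (obj 19) true && chain5 (obj 14) false.
Proof. by vm_cast_no_check (erefl true). Qed.
Lemma size_objs : size objs = 50. Proof. by []. Qed.

(** * The fifty indecomposable objects for n = 5 *)

Local Open Scope lfun_scope.

Section Exact.
Variables (k : fieldType) (n : nat) (X E K : dobj).
Hypotheses (hX : good k n X) (hE : good k n E) (hK : good k n K).
Variables (G A R S : table).
Hypothesis chk : exact_check X E K G A R S.

Let mG : 'M[k]__ := mxz k (dim E) (dim X) G.
Let mA : 'M[k]__ := mxz k (dim K) (dim E) A.
Let mR : 'M[k]__ := mxz k (dim E) (dim K) R.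
Let mS : 'M[k]__ := mxz k (dim X) (dim E) S.

Lemma morbP Y Z (hY : good k n Y) (hZ : good k n Z) M :
  morb Y Z M -> lmx (mxz k (dim Y) (dim Z) M) \in mor (realize hY) (realize hZ).
Proof.
case/andP=> /maskb_stays sM /eqfP eM; apply/lmx_mor; split; first exact: sM.
by rewrite !mxz_mulf; apply/matrixP => i j; rewrite !mxE eM.
Qed.

Lemma exact_mor : lmx mG \in mor (realize hE) (realize hX).
Proof. by case/and5P: chk => H *; apply: morbP. Qed.

(** Since R A + G S = 1, a map c with c G = 0 equals c R A; the factor c R preserves U
    because R does, and commutes with T because A is injective. *)
Lemma exact_kernel : @kernel_of _ _ (realize hE) (realize hX) (lmx mG) (realize hK) (lmx mA).
Proof.
have /and5P[_ HA /maskb_stays/stays_inP HR /eqfP AG /andP[/eqfP AR /eqfP RS]] := chk.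
have eAG : mA *m mG = 0.
  by rewrite mxz_mulf; apply/matrixP => i j; rewrite !mxE AG.
have eAR : mA *m mR = 1%:M.
  by rewrite mxz_mulf; apply/matrixP => i j; rewrite !mxE AR // /idf -val_eqE; case: eqP.
have eRS : mR *m mA + mG *m mS = 1%:M.
  rewrite !mxz_mulf; apply/matrixP => i j; rewrite !mxE.
  have e : mulf (dim K) R A i j + mulf (dim X) G S i j = idf i j by apply: RS.
  rewrite -rmorphD /= e.
  by rewrite /idf -val_eqE; case: eqP.
have kA : lker (lmx mA) == 0%VS.
  apply/lker0P => u v /(congr1 (lmx mR)); rewrite !lmxE -!mulmxA eAR.
  by rewrite !mulmx1.
have mAm : lmx mA \in mor (realize hK) (realize hE) by apply: morbP.
split=> //; first by rewrite lmx_comp eAG; apply/lfunP => v; rewrite lmxE mulmx0 zero_lfunE.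
move=> W c mc gc.
have cE w : lmx mA (lmx mR (c w)) = c w.
  have : lmx mG (c w) = 0 by rewrite (comp_at _ gc) zero_lfunE.
  rewrite !lmxE => cG; rewrite -mulmxA -[RHS]mulmx1 -eRS mulmxDr (mulmxA _ mG) cG.
  by rewrite mul0mx addr0.
exists (lmx mR \o c); last by apply/lfunP => w; rewrite !comp_lfunE cE.
have /lker0P injA := kA.
apply: mor_intro => [u Uu|w]; rewrite !comp_lfunE.
  by rewrite lmxE; apply/HR/(morU mc).
by apply: injA; rewrite cE (morT _ mc) (morT _ mAm) cE.
Qed.
End Exact.

Lemma objP (P : pred dobj) i : P zobj -> all P objs -> P (obj i).
Proof.
move=> P0 /(all_nthP zobj) H; have [lt|ge] := ltnP i (size objs); first exact: H.
by rewrite /obj nth_default.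
Qed.

Lemma obj_in (P : pred dobj) i : (i < 50)%N -> all P objs -> P (obj i).
Proof. by move=> lt /(all_nthP zobj) H; apply: H; rewrite size_objs. Qed.

Section Five.
Variable k : fieldType.

Lemma good_obj i n : nilp_check n (obj i) -> good k n (obj i).
Proof.
move=> nil; apply: good_check => //.
apply: (@objP (fun X => maskb X X (tm X))) ; first by [].
by apply: sub_all objs_checkT => X /andP[/andP[]].
Qed.

Lemma nilp5 i : nilp_check 5 (obj i).
Proof.
apply: (@objP (nilp_check 5)) ; first by [].
by apply: sub_all objs_checkT => X /andP[/andP[]].
Qed.

Definition good5 i := good_obj (nilp5 i).
Definition indec5 (i : 'I_50) : invSubspace k 5 := realize (good5 i).

Fixpoint good_csum_list (l : seq nat) : good k 5 (csum_list l) :=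
  if l is i :: l' then good_csum (good5 i) (good_csum_list l') else good_zobj k 5.

Definition sumobj l := realize (good_csum_list l).

Lemma in_add_iso (I : finType) (X : I -> invSubspace k 5) Y Z :
  isomorphic Y Z -> in_add X Z -> in_add X Y.
Proof.
by case/isomorphicP=> f mf [g mg [gf _]]; apply: in_add_retract mg mf gf.
Qed.

Lemma in_add_sumobj l : all (gtn 50) l -> in_add indec5 (sumobj l).
Proof.
elim: l => [_|i l IH /= /andP[i50 /IH al]].
  by apply: in_add0; apply/lfunP => v; apply/rowP => -[].
apply: in_add_iso (csum_iso (good5 i) (good_csum_list l) (good_csum_list (i :: l))) _.
by apply: in_add_dsum al; apply: (in_add_X indec5 (Ordinal i50)).
Qed.

Lemma dim_sumobj Z l :
  \dim (mor Z (sumobj l)) = sumn [seq \dim (mor Z (realize (good5 i))) | i <- l].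
Proof.
elim: l => [|i l IH] /=.
  apply/eqP; rewrite dimv_eq0 -subv0; apply/subvP => f _; rewrite memv0.
  by apply/eqP/lfunP => v; apply/rowP => -[].
rewrite (dimHom_isor _ (csum_iso (good5 i) (good_csum_list l) (good_csum_list (i :: l)))).
by rewrite dimHom_dsum IH.
Qed.

Lemma dim_indec5 i j h : hdim (obj i) (obj j) = Some h ->
  \dim (mor (realize (good5 i)) (realize (good5 j))) = h.
Proof. exact: hdimP. Qed.

Lemma almost_split_ok (j : 'I_50) : almost_split_check j.
Proof. by have /allP H := almost_split_checkT; apply: H; rewrite mem_iota ltn_ord. Qed.

Lemma dims_ok (i j : 'I_50) :
  (\dim (mor (indec5 i) (sumobj (asE (as_seq j)))) + (i == j) =
   \dim (mor (indec5 i) (indec5 j)) + \dim (mor (indec5 i) (sumobj (asK (as_seq j)))))%N.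
Proof.
have := dims_checkT; rewrite /dims_check; set H := map _ _ => /andP[/allP someH /allP dimH].
pose h a b := odflt 0%N (nth None (nth [::] H a) b).
have hE a b : (a < 50)%N -> (b < 50)%N ->
    \dim (mor (realize (good5 a)) (realize (good5 b))) = h a b.
  move=> la lb; apply: dim_indec5.
  have rowE : nth [::] H a = [seq hdim (obj a) y | y <- objs].
    by rewrite (nth_map zobj) ?size_objs.
  have entE : nth None (nth [::] H a) b = hdim (obj a) (obj b).
    by rewrite rowE (nth_map zobj) ?size_objs.
  rewrite /h entE -entE.
  have : isSome (nth None (nth [::] H a) b).
    apply: (allP (someH (nth [::] H a) _)); last by rewrite rowE mem_nth // size_map size_objs.
    by apply: mem_nth; rewrite size_map size_objs.
  by rewrite entE; case: hdim.
have sumE' l : all (gtn 50) l ->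
    sumn [seq \dim (mor (indec5 i) (realize (good5 m))) | m <- l] = sumn [seq h i m | m <- l].
  by move=> /allP l50; congr sumn; apply/eq_in_map => m /l50 m50; apply: hE.
have /and3P[E50 K50 _] := almost_split_ok j.
rewrite !dim_sumobj !sumE' // /indec5 hE //.
have io (m : 'I_50) : (m : nat) \in iota 0 50 by rewrite mem_iota ltn_ord.
have /allP dimHj := dimH _ (io j).
exact: (eqP (dimHj _ (io i))).
Qed.

Section Chain.
Variables (X : dobj) (b : bool) (hX : good k 5 X).
Hypothesis cX : chain5 X b.
Variables (Y : invSubspace k 5) (l : 'Hom(space Y, k^o)).

(** The morphism into the cofree object on one Jordan block that corresponds to the
    functional l. *)
Definition orbit_map : 'Hom(space Y, 'rV[k]_(dim X)) :=
  linfun (fun v => \row_(a < dim X) (l (iter a (oper Y) v) : k)).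

Lemma iter_lin m : linear (fun v : space Y => iter m (oper Y) v).
Proof. by move=> c u v; elim: m => //= m ->; rewrite linearP. Qed.

Lemma orbit_mapE v (a : 'I_(dim X)) : orbit_map v 0 a = l (iter a (oper Y) v).
Proof.
rewrite linfunE ?mxE // => c u w; apply/rowP => i; rewrite !mxE iter_lin linearP.
by [].
Qed.

Lemma orbit_map_oper v : orbit_map (oper Y v) = lmx (opm k X) (orbit_map v).
Proof.
have /and3P[/eqP d5 _ /eqfP T] := cX.
apply/rowP => j; rewrite lmxE mxE orbit_mapE -iterSr.
have TE (i : 'I_(dim X)) : opm k X i j = (i == j.+1 :> nat)%:R.
  rewrite mxE T ?(leq_trans (ltn_ord _)) ?d5 //.
  by case: eqP.
have [lt|ge] := ltnP j.+1 (dim X).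
  rewrite (bigD1 (Ordinal lt)) //= TE eqxx mulr1 orbit_mapE big1 ?addr0 // => i ij.
  by rewrite TE -[_ == _]/(i == Ordinal lt) (negbTE ij) mulr0.
rewrite big1 => [|i _]; last by rewrite TE ltn_eqF ?mulr0 // (leq_trans (ltn_ord i)).
have -> : j.+1 = 5 by apply/eqP; rewrite eqn_leq -{1}d5 ltn_ord -d5.
by rewrite oper_nilp linear0.
Qed.

Lemma orbit_map0 v : orbit_map v = 0 <-> forall m, l (iter m (oper Y) v) = 0.
Proof.
have /and3P[/eqP d5 _ _] := cX; split=> [e m|e]; last first.
  by apply/rowP => a; rewrite orbit_mapE e mxE.
have [lt|ge] := ltnP m (dim X).
  by rewrite -(orbit_mapE v (Ordinal lt)) e mxE.
rewrite d5 in ge; rewrite -(subnK ge) iterD oper_nilp.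
suff -> : iter (m - 5) (oper Y) 0 = 0 by rewrite linear0.
by elim: (m - 5)%N => //= i ->; rewrite linear0.
Qed.

Lemma orbit_map_mor : b \/ (forall u, u \in subsp Y -> l u = 0) ->
  orbit_map \in mor Y (realize hX).
Proof.
have /and3P[/eqP d5 /eqP mX _] := cX => bU.
apply: mor_intro => [u Uu|v]; last exact: orbit_map_oper.
apply/maskUP => a; rewrite /inU mX; case: bU => [->|lU].
  have a5 : (a < 5)%N by have := ltn_ord a; rewrite [X in (_ < X)%N -> _]d5.
  by rewrite nth_nseq a5.
move=> _; rewrite orbit_mapE lU //.
by elim: (a : nat) => //= m IH; apply: (subvP (oper_stable Y)); apply: memv_img.
Qed.

End Chain.

Lemma indec5_full (Y : invSubspace k 5) (l : 'Hom(space Y, k^o)) :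
  exists i (q : 'Hom(space Y, space (indec5 i))), q \in mor Y (indec5 i) /\
    forall v, q v = 0 <-> forall m, l (iter m (oper Y) v) = 0.
Proof.
have /andP[c19 _] := chainT; exists (inord 19).
have c : chain5 (obj (inord 19 : 'I_50)) true by rewrite inordK.
exists (orbit_map (obj (inord 19 : 'I_50)) l); split.
  by apply: (orbit_map_mor _ c); left.
by move=> v; apply: (orbit_map0 c).
Qed.

Lemma indec5_null (Y : invSubspace k 5) (l : 'Hom(space Y, k^o)) :
  (forall u, u \in subsp Y -> l u = 0) ->
  exists i (q : 'Hom(space Y, space (indec5 i))), q \in mor Y (indec5 i) /\
    forall v, q v \in subsp (indec5 i) -> l v = 0.
Proof.
move=> lU; have /andP[_ c14] := chainT; exists (inord 14).
have c : chain5 (obj (inord 14 : 'I_50)) false by rewrite inordK.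
exists (orbit_map (obj (inord 14 : 'I_50)) l); split.
  by apply: (orbit_map_mor _ c); right.
have /and3P[/eqP d5 /eqP m0 _] := c => v /maskUP qv.
suff /(orbit_map0 c)/(_ 0%N) : orbit_map (obj (inord 14 : 'I_50)) l v = 0 by [].
by apply/rowP => a; rewrite qv ?mxE // /inU m0 nth_nil.
Qed.

Lemma indec5_scalar_check (i : 'I_50) : scalar_check (obj i).
Proof.
apply: (@obj_in scalar_check); first exact: ltn_ord.
by apply: sub_all objs_checkT => X /andP[].
Qed.

Theorem classification5 :
  [/\ forall i, indecomposable (indec5 i),
      forall i j, isomorphic (indec5 i) (indec5 j) -> i = j &
      forall Y, indecomposable Y -> exists i, isomorphic Y (indec5 i)].
Proof.
apply: (classification (E := fun j => sumobj (asE (as_seq j)))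
  (K := fun j => sumobj (asK (as_seq j)))
  _ _ indec5_full indec5_null (g := fun j => lmx (mxz k _ _ (matG j)))
  (a := fun j => lmx (mxz k _ _ (matA j)))).
- by move=> i; apply: scalar_check_nz; apply: indec5_scalar_check.
- by move=> i f; apply: scalar_checkP; apply: indec5_scalar_check.
- by move=> j; case/and3P: (almost_split_ok j) => _ _ H; apply: exact_mor H.
- by move=> j; case/and3P: (almost_split_ok j) => _ _ H; apply: exact_kernel H.
- by move=> j; case/and3P: (almost_split_ok j) => H _ _; apply: in_add_sumobj.
- by move=> j; case/and3P: (almost_split_ok j) => _ H _; apply: in_add_sumobj.
exact: dims_ok.
Qed.

End Five.

(** * Passing to smaller n *)

Section Smaller.
Variables (k : fieldType) (n : nat).
Hypothesis n5 : (1 <= n <= 5)%N.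
Implicit Types Y Z : invSubspace k n.

Lemma lift_nilp Y v : iter 5 (oper Y) v = 0.
Proof.
have /andP[_ le] := n5; rewrite -(subnK le) iterD oper_nilp.
by elim: (5 - n)%N => //= i ->; rewrite linear0.
Qed.
Definition lift Y : invSubspace k 5 := InvSubspace (@lift_nilp Y) (oper_stable Y).

(** Lifting only changes the recorded exponent. *)
Lemma lift_iso Y Z : isomorphic (lift Y) (lift Z) <-> isomorphic Y Z.
Proof. by []. Qed.

Lemma isomorphic_refl m (Z : invSubspace k m) : isomorphic Z Z.
Proof.
by apply/isomorphicP; exists \1; [|exists \1]; rewrite ?mor1 ?comp_lfun1l.
Qed.

(** The power T^n is transported along an isomorphism. *)
Lemma iso_nilp Y (Z : invSubspace k 5) :
  isomorphic (lift Y) Z -> forall v, iter n (oper Z) v = 0.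
Proof.
case/isomorphicP=> f mf [g mg [gf fg]] v.
have fgv : f (g v) = v by rewrite (comp_at _ fg) id_lfunE.
by rewrite -fgv -(mor_iter _ _ mf) /= oper_nilp linear0.
Qed.

(** The operator satisfies T^n = 0 on the summands of a lifted object, so they come from the
    smaller category. *)
Lemma lift_indec Y : indecomposable (lift Y) <-> indecomposable Y.
Proof.
split=> -[Y0 Yind]; split=> // -[A [B [A0 B0 iso]]]; apply: Yind.
  by exists (lift A), (lift B).
have nil := iso_nilp iso.
have nA v : iter n (oper A) v = 0.
  by have := nil (injl A B v); rewrite -(mor_iter _ _ (injl_mor A B)) injlE => /(congr1 fst).
have nB v : iter n (oper B) v = 0.
  by have := nil (injr A B v); rewrite -(mor_iter _ _ (injr_mor A B)) injrE => /(congr1 snd).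
by exists (InvSubspace nA (oper_stable A)), (InvSubspace nB (oper_stable B)).
Qed.

(** Vanishing of T^n over the given field forces vanishing over the integers, since a
    non-zero power has an entry 1 or -1. *)
Lemma nilp_check_obj (i : 'I_50) :
  (forall v, iter n (oper (indec5 k i)) v = 0) -> nilp_check n (obj i).
Proof.
move=> nil; have : nilp_check n (obj i) || unit_power n (obj i).
  apply: (@obj_in (fun X => nilp_check n X || unit_power n X)); first exact: ltn_ord.
  have /allP := nilp_unit_checkT; apply; rewrite mem_iota; exact: n5.
case/orP=> // /hasP[a]; rewrite mem_iota /= add0n => la.
case/hasP=> b; rewrite mem_iota /= add0n => lb.
pose w : 'rV[k]_(dim (obj i)) := delta_mx 0 (Ordinal la).
have := iter_powt n (tm (obj i)) w; have /= -> := nil w; rewrite -rowE.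
move=> /rowP/(_ (Ordinal lb)); rewrite !mxE /= => /esym e.
case/orP=> /eqP u; move/eqP: e; rewrite u ?oner_eq0 //.
by rewrite oppr_eq0 oner_eq0.
Qed.

Definition nilp_idx := [seq j <- iota 0 50 | nilp_check n (obj j)].

Lemma nilp_idxP (i : 'I_(size nilp_idx)) : nilp_check n (obj (nth 0%N nilp_idx i)).
Proof. by have := mem_nth 0%N (ltn_ord i); rewrite mem_filter => /andP[]. Qed.

Lemma nilp_idx_lt (i : 'I_(size nilp_idx)) : (nth 0%N nilp_idx i < 50)%N.
Proof. by have := mem_nth 0%N (ltn_ord i); rewrite mem_filter mem_iota => /andP[]. Qed.

Definition indecn (i : 'I_(size nilp_idx)) : invSubspace k n := realize (good_obj k (nilp_idxP i)).

Lemma lift_indecn i : isomorphic (lift (indecn i)) (indec5 k (Ordinal (nilp_idx_lt i))).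
Proof. exact: (isomorphic_refl (indec5 k (Ordinal (nilp_idx_lt i)))). Qed.

Lemma lift_indecn_at (i : 'I_(size nilp_idx)) (j : 'I_50) :
  nth 0%N nilp_idx i = j -> isomorphic (lift (indecn i)) (indec5 k j).
Proof.
move=> e; suff <- : Ordinal (nilp_idx_lt i) = j by apply: lift_indecn.
exact: (@ord_inj 50 (Ordinal (nilp_idx_lt i)) j e).
Qed.

Theorem num_indecn : num_indecomposables k n (size nilp_idx).
Proof.
have [ind1 ind2 ind3] := classification5 k.
exists indecn; split=> [i|i j iso|Y Yind].
- apply/lift_indec; have [X0 Xind] := ind1 (Ordinal (nilp_idx_lt i)).
  have iso := lift_indecn i; split; first exact: nonzero_iso (isomorphic_sym iso) X0.
  by case=> A [B [A0 B0 isoAB]]; apply: Xind; exists A, B.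
- have : isomorphic (indec5 k (Ordinal (nilp_idx_lt i))) (indec5 k (Ordinal (nilp_idx_lt j))).
    apply: isomorphic_trans (isomorphic_sym (lift_indecn i)) _.
    by apply: isomorphic_trans (lift_indecn j); apply/lift_iso.
  move/ind2/(congr1 (@nat_of_ord 50)) => e; apply: val_inj; apply/eqP.
  rewrite -(nth_uniq 0%N (ltn_ord i) (ltn_ord j)) ?filter_uniq ?iota_uniq //.
  exact/eqP.
have [j iso] := ind3 _ ((lift_indec Y).2 Yind).
have jn := nilp_check_obj (iso_nilp iso).
have jidx : (j : nat) \in nilp_idx by rewrite mem_filter jn mem_iota ltn_ord.
have lt : (index (j : nat) nilp_idx < size nilp_idx)%N by rewrite index_mem.
exists (Ordinal lt); apply/lift_iso; apply: isomorphic_trans iso _.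
have e : nth 0%N nilp_idx (Ordinal lt) = j := nth_index 0%N jidx.
exact: isomorphic_sym (lift_indecn_at e).
Qed.

End Smaller.

Local Close Scope lfun_scope.

Theorem mainTheorem10 (k : fieldType) (n : nat) (hn : (1 <= n <= 5)%N) :
  finite_representation_type k n /\
  exists s : nat,
    num_indecomposables k n s /\
    s%:R = 2 + 2 * (n%:R - 1) * (6 / (6 - n%:R)) :> rat.
Proof.
have num := num_indecn k hn; split.
  by have [X [_ _ X3]] := num; exists (size (nilp_idx n)), X.
exists (size (nilp_idx n)); split=> //.
case: n hn {num} => [|[|[|[|[|[|n]]]]]] hn; [by []| | | | | |by []].
- have -> : size (nilp_idx 1) = 2 by vm_compute.
  by apply/eqP.
- have -> : size (nilp_idx 2) = 5 by vm_compute.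
  by apply/eqP.
- have -> : size (nilp_idx 3) = 10 by vm_compute.
  by apply/eqP.
- have -> : size (nilp_idx 4) = 20 by vm_compute.
  by apply/eqP.
have -> : size (nilp_idx 5) = 50 by vm_compute.
by apply/eqP.
Qed.
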